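(* Let $\nu$ be a probability measure on $\mathbb{R}$ with a finite first moment, and put $m=\int_{\mathbb{R}} x\,d\nu(x)$. Then for every $p\in(0,1)\setminus\{p_c\}$, $$\lim_{n\to+\infty}\frac{1}{|\Lambda_n|}\sum_{x\in\Lambda_n}X(x)=(1-\theta(p))\,m+\theta(p)\,Z\qquad P^{p,\nu}\text{-almost surely},$$ where $Z$ is the value taken by $X(\cdot)$ along the infinite connected component of $G$ if it exists, and $Z=0$ otherwise.
   Context: Fix an integer $d\ge 1$. $\mathbb{L}^d=(\mathbb{Z}^d,E_d)$ is the cubic lattice, $E_d=\{\{x,y\}\subset\mathbb{Z}^d:\sum_{i=1}^d|x_i-y_i|=1\}$. A subgraph of $\mathbb{L}^d$ means a graph $G=(\mathbb{Z}^d,E)$ with $E\subset E_d$. Its connected components are also called clusters, and $C(x)$ is the cluster of $x$. For $p\in(0,1)$, $\mu_p$ is the law of the random subgraph obtained by Bernoulli bond percolation: each edge of $E_d$ is kept independently with probability $p$. Put $\theta(p)=\mu_p(|C(0)|=+\infty)$ and $p_c=\inf\{p\in(0,1):\theta(p)>0\}$ (with $\inf\varnothing=1$). It is known that for $\mu_p$-almost every $G$ there is no infinite cluster if $p<p_c$, and exactly one infinite cluster if $p>p_c$. For a subgraph $G$ of $\mathbb{L}^d$ and a probability measure $\nu$ on $\mathbb{R}$, the color measure $P^{G,\nu}$ is the unique probability measure on $(\mathbb{R}^{\mathbb{Z}^d},\mathcal{B}(\mathbb{R}^{\mathbb{Z}^d}))$ under which the canonical projections $X(x)=X_x:\omega\mapsto\omega_x$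 satisfy: each $X_x$ has law $\nu$; for every set $S\subset\mathbb{Z}^d$ whose elements lie in pairwise distinct clusters of $G$, the variables $(X_x)_{x\in S}$ are independent; for every connected set $S$ of $G$, the variables $(X_x)_{x\in S}$ are ($P^{G,\nu}$-a.s.) all equal. The randomized (annealed) color measure is $P^{p,\nu}=\int P^{G,\nu}\,d\mu_p(G)$. Assertions under $P^{p,\nu}$ that also involve $G$ or $Z$ are understood on the space of pairs $(G,X)$ where $G$ has law $\mu_p$ and, given $G$, $X$ has law $P^{G,\nu}$ (so that $X$ has law $P^{p,\nu}$). $\Lambda_n=\{-n,\dots,n\}^d$, and $|\cdot|$ denotes cardinality. *)

(* Defs.v *)
From HB Require Import structures.
From mathcomp Require Export all_boot all_order all_algebra.
From mathcomp Require Export finmap.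
From mathcomp Require Export all_classical all_reals all_analysis.
From mathcomp Require Export measurable_realfun.
#[export] Set Implicit Arguments.
#[export] Unset Strict Implicit.
#[export] Unset Printing Implicit Defensive.
Export Order.TTheory GRing.Theory Num.Theory.
Export numFieldNormedType.Exports.

Local Open Scope classical_set_scope.
Local Open Scope ring_scope.

(* The product sigma-algebra on [I -> T], generated by the coordinate maps.
   For [I] countable and [T] the real line it is the Borel sigma-algebra of the
   product topology. *)
Definition coordinate_sets (I : Type) (disp : measure_display)
    (T : measurableType disp) : set (set (I -> T)) :=
  [set C | exists i (B : set T), measurable B /\ C = [set f | B (f i)]].

Definition product_space (I : Type) (disp : measure_display)
    (T : measurableType disp) :
    measurableType ((@coordinate_sets I disp T).-sigma) :=
  g_sigma_algebraType (@coordinate_sets I disp T).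

Definition independent_family (disp disp' : measure_display)
    (Omega : measurableType disp) (T : measurableType disp') (R : realType)
    (P : {measure set Omega -> \bar R}) (I : choiceType) (S : set I)
    (X : I -> Omega -> T) : Prop :=
  forall (F : {fset I}) (B : I -> set T),
    [set` F] `<=` S ->
    (forall i, i \in F -> measurable (B i)) ->
    P (\bigcap_(i in [set` F]) X i @^-1` B i) =
      (\prod_(i <- F) P (X i @^-1` B i))%E.

Definition vertex (d : nat) : Type := {ffun 'I_d -> int}.

Definition lattice_edges (d : nat) : set {fset vertex d} :=
  [set e | exists x y : vertex d,
     e = [fset x; y]%fset /\ \sum_(i < d) `|x i - y i| = 1].
Arguments lattice_edges : clear implicits.

Definition edge (d : nat) := set_type (lattice_edges d).

(* A subgraph [(Z^d, E)] of the cubic lattice is encoded by the indicator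
   function of [E]. *)
Definition subgraph (d : nat) := product_space (edge d) bool.

Definition coloring (R : realType) (d : nat) := product_space (vertex d) R.

Section clusters.
Context (d : nat) (G : subgraph d).

Definition adjacent (x y : vertex d) : Prop :=
  exists e : edge d, val e = [fset x; y]%fset /\ G e.

Definition walk (x : vertex d) (s : seq (vertex d)) (y : vertex d) : Prop :=
  path [rel u v | `[< adjacent u v >]] x s /\ last x s = y.

Definition cluster (x : vertex d) : set (vertex d) :=
  [set y | exists s, walk x s y].

Definition connected_in (S : set (vertex d)) : Prop :=
  forall x y, S x -> S y -> exists2 s, walk x s y & [set` s] `<=` S.

Definition in_distinct_clusters (S : set (vertex d)) : Prop :=
  forall x y, S x -> S y -> x <> y -> cluster x <> cluster y.

Definition infinite_sites : set (vertex d) :=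
  [set x | infinite_set (cluster x)].

(* When [G] has several infinite clusters one of them is chosen. *)
Definition infinite_cluster_value (R : realType) (f : coloring R d) : R :=
  if `[< infinite_sites !=set0 >] then f (xget 0 infinite_sites) else 0.

End clusters.

Definition bernoulli_percolation (R : realType) (d : nat) (p : R)
    (mu : probability (subgraph d) R) : Prop :=
  (forall e : edge d, mu [set G | G e] = p%:E) /\
  independent_family mu [set: edge d] (fun e (G : subgraph d) => G e).

Definition theta (R : realType) (d : nat)
    (mu : probability (subgraph d) R) : R :=
  fine (mu [set G | infinite_set (cluster G 0)]).

(* The library's [inf set0] is [0], whereas the convention here is [1]. *)
Definition critical_probability (R : realType) (d : nat)
    (mu : R -> probability (subgraph d) R) : R :=
  let supercritical := [set p | 0 < p < 1 /\ 0 < theta (mu p)] in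
  if `[< supercritical !=set0 >] then inf supercritical else 1.

Definition color_measure (R : realType) (d : nat) (G : subgraph d)
    (nu : probability R R) (P : {measure set (coloring R d) -> \bar R}) : Prop :=
  [/\ forall (x : vertex d) (B : set R), measurable B ->
        P [set f | B (f x)] = nu B,
      forall S : set (vertex d), in_distinct_clusters G S ->
        independent_family P S (fun x (f : coloring R d) => f x) &
      forall S : set (vertex d), connected_in G S ->
        {ae P, forall f : coloring R d, forall x y, S x -> S y -> f x = f y}].

Section annealed.
Context (disp disp' : measure_display) (T : measurableType disp)
  (U : measurableType disp') (R : realType)
  (mu : probability T R) (k : R.-pker T ~> U).

(* The law of a pair whose first component has law [mu] and whose second
   component has conditional law [k x] given that the first one is [x]. *)
Definition joint_law (A : set (T * U)) : \bar R :=
  (\int[mu]_x k x (xsection A x))%E.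

Let joint_law0 : joint_law set0 = 0%E.
Proof. by apply: integral0_eq => x _; rewrite xsection0 measure0. Qed.

Let joint_law_ge0 A : (0 <= joint_law A)%E.
Proof. by apply: integral_ge0 => x _; exact: measure_ge0. Qed.

Let joint_law_sigma_additive : semi_sigma_additive joint_law.
Proof.
move=> F mF tF mUF; rewrite /joint_law.
have mk n : measurable_fun [set: T] ((fun x => k x (xsection (F n) x)) : T -> \bar R).
  by apply: measurable_fun_xsection_finite_kernel; rewrite inE.
rewrite [X in _ --> X](_ : _ =
    (\sum_(0 <= n <oo) \int[mu]_x k x (xsection (F n) x))%E); last first.
  rewrite -integral_nneseries//; apply: eq_integral => x _.
  rewrite xsection_bigcup measure_semi_bigcup//.
  - by move=> n; exact: measurable_xsection.
  - exact: trivIset_xsection.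
  - by apply: bigcup_measurable => n _; exact: measurable_xsection.
by apply: is_cvg_ereal_nneg_natsum => n _; exact: joint_law_ge0.
Qed.

HB.instance Definition _ := isMeasure.Build _ _ _ joint_law
  joint_law0 joint_law_ge0 joint_law_sigma_additive.

Let joint_law_setT : joint_law setT = 1%E.
Proof.
rewrite /joint_law (eq_integral (cst 1%E)); last first.
  by move=> x _; rewrite xsectionE preimage_setT prob_kernel.
by rewrite integral_cst// mul1e; exact: probability_setT.
Qed.

HB.instance Definition _ :=
  Measure_isProbability.Build _ _ _ joint_law joint_law_setT.

End annealed.

Definition box (d n : nat) : set (vertex d) :=
  [set x | forall i, `|x i| <= n%:Z].
Arguments box : clear implicits.

(* Main.v *)
(* Uniqueness of the infinite cluster follows the finite-volume form of the
   Aizenman-Kesten-Newman argument. In a box, explore the clusters that reach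
   the boundary, and let the score of a cluster C be b/q - a/p, where a and b
   count the open and the closed edges touching C and q = 1 - p. The score of
   the union of these clusters has mean zero, while the sum of their scores
   exceeds it by 1/q for each closed edge joining two of them. A change of
   measure from p to p - delta bounds the score of C(x) by W / delta + K delta
   (a + b) with W of mean one; summing over boundary vertices x, one per
   cluster, the mean number of such edges is at most a constant times
   |boundary| / delta + delta |box| for every delta, hence o(|box|). By
   translation invariance an edge almost surely does not join two infinite
   clusters, and insertion tolerance gives uniqueness.

   The law of (G, X) is translation invariant, since the color measure is
   determined by G. A weak (1,1) maximal inequality (Vitali covering by boxes)
   shows that the set of f whose box averages converge almost surely to a
   constant is closed in L^1. It contains the indicators of {C(0) in Lambda_K,
   X(0) in B}, because their translates far apart are independent, and hence
   phi(X(0)) on {C(0) finite} for phi integrable with respect to nu. Taking phi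
   = id and phi = 1 handles the finite clusters and the density of the infinite
   one, on which X is constant, equal to Z. *)

Require Import Defs.
From mathcomp Require Import ring lra zify.

Local Open Scope classical_set_scope.
Local Open Scope ring_scope.

(** The field X is not ergodic: on the infinite cluster its limit is the random value Z. Only the
    contribution of finite clusters goes through the law of large numbers, and there every limit is
    a constant. For a finite-range event E of probability q, decorrelation controls the box average
    A_N of its indicator in mean square only. Almost sure convergence is carried by 1_E - A_N, a
    mean of differences between 1_E and its translates, whose own averages vanish by counting points
    near the boundary of a box; the maximal inequality absorbs A_N - q.

    For uniqueness, p is lowered rather than raised because closed edges score positively: the
    likelihood ratio of p - delta to p then grows with the score. Its logarithm is delta times the
    score, up to an error K delta^2 per edge, and 1 + u <= exp u makes the bound linear. The ratio
    runs over the edges touching C(x); an exploration finds them, which is why W has mean one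
    although the set is random. Since 1 / delta is paid per boundary vertex and delta per edge,
    delta is fixed first and the box grows afterwards. *)

Local Notation image_measure :=
  measure_function_pushforward__canonical__measure_function_Measure.

(** * Two-arm edges of a finite graph *)

Section finite_percolation.
Context (R : realType) (V E : finType) (src tgt : E -> V) (D : {set V}).
Implicit Types (w : {ffun E -> bool}) (e : E) (x y : V).

Definition fin_adj w : rel V := fun x y => [exists e, w e &&
  ((src e == x) && (tgt e == y) || (src e == y) && (tgt e == x))].

Definition touches w x e :=
  connect (fin_adj w) x (src e) || connect (fin_adj w) x (tgt e).

Lemma fin_adj_sym w : symmetric (fin_adj w).
Proof. by move=> x y; apply: eq_existsb => e; rewrite orbC. Qed.

Lemma fin_conn_sym w : connect_sym (fin_adj w).
Proof. exact/sym_connect_sym/fin_adj_sym. Qed.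

(** An exploration of the cluster of [x] looks at no other edge: while a path has stayed in the
    cluster under [w], its next edge touches that cluster, so both configurations agree on it. *)
Lemma connect_agree w w' x : (forall e, touches w x e -> w e = w' e) ->
  connect (fin_adj w) x =1 connect (fin_adj w') x.
Proof.
move=> ww' y; apply/idP/idP => /connectP[s].
- elim/last_ind: s y => [|s z IHs] y /=; first by move=> _ ->; exact: connect0.
  rewrite rcons_path last_rcons => /andP[ps szs] ->.
  have cw : connect (fin_adj w) x (last x s) by apply/connectP; exists s.
  apply: connect_trans (IHs _ ps erefl) (connect1 _).
  case/existsP: szs => e /andP[we ends]; apply/existsP; exists e.
  rewrite -ww' ?we// /touches.
  by case/orP: ends => /andP[/eqP-> /eqP->]; rewrite cw ?orbT.
- elim/last_ind: s y => [|s z IHs] y /=; first by move=> _ ->; exact: connect0.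
  rewrite rcons_path last_rcons => /andP[ps szs] ->.
  have cw := IHs _ ps erefl.
  apply: (connect_trans cw); apply: connect1.
  case/existsP: szs => e /andP[we ends]; apply/existsP; exists e.
  rewrite ww' ?we// /touches.
  by case/orP: ends => /andP[/eqP-> /eqP->]; rewrite cw ?orbT.
Qed.

(** The stopping property required by [stopping_set_weight]: the explored set is recognized from the
    states of its own edges. *)
Lemma touches_agree w w' x : (forall e, touches w x e -> w e = w' e) ->
  touches w' x =1 touches w x.
Proof. by move=> ww' e; rewrite /touches !(connect_agree ww'). Qed.

Definition bern (p : R) (b : bool) : R := if b then p else 1 - p.

Definition weight (p : R) w : R := \prod_e bern p (w e).

Lemma sum_weight p : \sum_w weight p w = 1.
Proof.
rewrite -(bigA_distr_bigA (fun _ => bern p)) big1// => e _.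
by rewrite big_bool /= /bern; ring.
Qed.

(* Exchanging the two configurations of an independent pair outside the
   explored set [J w] is an involution, and it preserves [J w]. *)
Lemma stopping_set_weight (p p' : R) (J : {ffun E -> bool} -> E -> bool) :
  (forall w w', (forall e, J w e -> w e = w' e) -> J w' =1 J w) ->
  \sum_w \prod_e (if J w e then bern p' (w e) else bern p (w e)) = 1.
Proof.
move=> stopJ.
pose mix (wv : {ffun E -> bool} * {ffun E -> bool}) :=
  ([ffun e => if J wv.1 e then wv.1 e else wv.2 e],
   [ffun e => if J wv.1 e then wv.2 e else wv.1 e]).
have Jmix wv : J (mix wv).1 =1 J wv.1.
  by apply: stopJ => e Je; rewrite /mix /= ffunE Je.
have mixK : involutive mix.
  move=> [w v]; rewrite {1}/mix; congr pair; apply/ffunP => e;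
    rewrite !ffunE (Jmix (w, v)) /=;
  by case: ifPn => Je; rewrite /mix /= ?ffunE /= ?Je ?(negbTE Je) ?ffunE.
have total : \sum_wv weight p' wv.1 * weight p wv.2 = 1.
  rewrite -(pair_bigA _ (fun w v => weight p' w * weight p v))/=.
  under eq_bigr do rewrite -mulr_sumr sum_weight mulr1.
  exact: sum_weight.
rewrite -[RHS]total (reindex_inj (inv_inj mixK))/=.
(* After the exchange the product regroups into the summand of the claim and a weight of [v] which,
   for fixed [w], sums to one. *)
rewrite (eq_bigr (fun wv : {ffun E -> bool} * {ffun E -> bool} =>
   (\prod_e (if J wv.1 e then bern p' (wv.1 e)
   else bern p (wv.1 e))) * \prod_e (if J wv.1 e then bern p (wv.2 e)
   else bern p' (wv.2 e)))).
  rewrite -(pair_bigA _ (fun w v : {ffun E -> bool} => (\prod_e (if J w e then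
    bern p' (w e)
   else bern p (w e))) * \prod_e (if J w e then bern p (v e)
   else bern p' (v e))))/=.
  apply: eq_bigr => w _; rewrite -mulr_sumr.
  rewrite -(bigA_distr_bigA (fun e b => if J w e then bern p b else bern p' b)).
  rewrite [X in _ * X]big1 ?mulr1// => e _.
  by rewrite big_bool /= /bern; case: ifP => _; ring.
move=> [w v] _; rewrite /weight -!big_split/=; apply: eq_bigr => e _.
by rewrite !ffunE; case: ifP => _; rewrite // mulrC.
Qed.

Variables p delta : R.
Hypotheses (p01 : 0 < p < 1) (delta_gt0 : 0 < delta) (delta_le : delta <= p /
  2).

Let q := 1 - p.

Let p_gt0 : 0 < p. Proof. by case/andP: p01. Qed.

Let q_gt0 : 0 < q. Proof. by rewrite /q subr_gt0; case/andP: p01. Qed.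

Let pd_gt0 : 0 < p - delta. Proof. by move: p_gt0 delta_le; lra. Qed.

Let qd_gt0 : 0 < q + delta. Proof. exact: addr_gt0. Qed.

(* Likelihood ratio of the parameters [p - delta] and [p]; [score] is its
   logarithmic derivative in [delta] at [0], which has mean zero. *)
Definition tilt (b : bool) : R := bern (p - delta) b / bern p b.

Definition tilted_weight w x : R := \prod_e (if touches w x e then tilt (w e)
  else 1).

(** The ratio replaces [p] by [p - delta] exactly on the explored edges, and such a mixture still
    has total mass one. *)
Lemma sum_tilted_weight x : \sum_w weight p w * tilted_weight w x = 1.
Proof.
rewrite -[RHS](@stopping_set_weight p (p - delta) (touches ^~ x)); last first.
  by move=> w w'; exact: touches_agree.
apply: eq_bigr => w _; rewrite -big_split/=; apply: eq_bigr => e _.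
case: ifP => _; last by rewrite mulr1.
rewrite /tilt mulrCA divff ?mulr1// gt_eqF// /bern; case: (w e) => /=;
  move: p_gt0 q_gt0; rewrite /q; lra.
Qed.

Definition score (b : bool) : R := if b then - p^-1 else q^-1.

(** Bounds the second-order error of both states. An open edge costs 1 / (p (p - delta)), at most 2
    / p^2 because delta <= p / 2; a closed edge costs 1 / (q (q + delta)), at most 1 / q^2. *)
Definition tilt_cost : R := 2 / p ^+ 2 + 1 / q ^+ 2.

(** The inequality exp u <= 1 / (1 - u) is used at u = - delta / (p - delta) for an open edge and u
    = delta / (q + delta) for a closed one, where 1 / (1 - u) is exactly the ratio. *)
Lemma tilt_ge b : expR (delta * (score b - tilt_cost * delta)) <= tilt b.
Proof.
have inv_expR (u : R) : u < 1 -> expR u <= (1 - u)^-1.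
  move=> u1; have := expR_ge1Dx (- u) => h.
  by rewrite -[expR u]invrK -expRN lef_pV2// ?posrE ?expR_gt0//; lra.
have cost_p : 2 / p ^+ 2 <= tilt_cost.
  by rewrite /tilt_cost lerDl divr_ge0// exprn_ge0// ltW.
have cost_q : 1 / q ^+ 2 <= tilt_cost.
  by rewrite /tilt_cost lerDr divr_ge0// exprn_ge0// ltW.
case: b; rewrite /tilt /bern /score.
- apply: (@le_trans _ _ (expR (- (delta / (p - delta))))).
    rewrite ler_expR -[leRHS]mulrN ler_pM2l//.
    have -> : - (p - delta)^-1 = - p^-1 - delta / (p * (p - delta)).
      by field; apply/andP; split; rewrite gt_eqF.
    rewrite lerD2l lerN2 (le_trans _ (ler_wpM2r (ltW delta_gt0) cost_p))//.
    rewrite mulrC ler_pM2r//.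
    rewrite -[leRHS]invf_div lef_pV2 ?posrE ?divr_gt0 ?exprn_gt0 ?mulr_gt0//.
    by rewrite expr2 -mulrA ler_pM2l//; move: p_gt0 delta_le; lra.
  apply: (le_trans (inv_expR _ _)).
    by apply: (@lt_le_trans _ _ 0) => //; rewrite oppr_lt0 divr_gt0.
  by rewrite le_eqVlt; apply/orP; left; apply/eqP; field;
    rewrite ?(gt_eqF pd_gt0) ?(gt_eqF p_gt0).
- apply: (@le_trans _ _ (expR (delta / (q + delta)))).
    rewrite ler_expR ler_pM2l//.
    have -> : (q + delta)^-1 = q^-1 - delta / (q * (q + delta)).
      by field; rewrite !(gt_eqF qd_gt0) (gt_eqF q_gt0).
    rewrite lerD2l lerN2 (le_trans _ (ler_wpM2r (ltW delta_gt0) cost_q))//.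
    rewrite mulrC ler_pM2r// mul1r lef_pV2 ?posrE ?exprn_gt0 ?(mulr_gt0 q_gt0
      qd_gt0)//.
    by rewrite expr2 ler_pM2l// lerDl ltW.
  apply: (le_trans (inv_expR _ _)).
    by rewrite (ltr_pdivrMr _ _ qd_gt0) mul1r ltrDr.
  rewrite le_eqVlt; apply/orP; left; apply/eqP; rewrite -/q.
  have -> : 1 - (p - delta) = q + delta by rewrite /q; ring.
  by field; rewrite (gt_eqF qd_gt0) (gt_eqF q_gt0).
Qed.

(** Multiply [tilt_ge] over the edges touching the cluster, then bound the exponential below by 1 +
    u. *)
Lemma sum_score_le w x : \sum_(e | touches w x e) score (w e) <=
  tilted_weight w x / delta + tilt_cost * delta * #|touches w x|%:R.
Proof.
have : delta * \sum_(e | touches w x e) (score (w e) - tilt_cost * delta)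
    <= tilted_weight w x.
  rewrite /tilted_weight -big_mkcond/=.
  apply: (@le_trans _ _ (expR (\sum_(e | touches w x e)
     delta * (score (w e) - tilt_cost * delta)))).
    by rewrite -mulr_sumr (le_trans _ (expR_ge1Dx _))// lerDr.
  rewrite expR_sum; apply: ler_prod => e _.
  by rewrite expR_ge0 tilt_ge.
rewrite mulrC -ler_pdivlMr// sumrB sumr_const lerBlDr.
by rewrite mulr_natr.
Qed.

Definition wired w y := [exists x in D, connect (fin_adj w) x y].

(** All members of a cluster see the same predicate, hence the same [pick]. Each wired cluster thus
    has exactly one representative, and a sum over wired clusters becomes a sum over part of [D]. *)
Definition representative w x :=
  (x \in D) && ([pick y in D | connect (fin_adj w) x y] == Some x).

Definition two_arms w e :=
  [&& wired w (src e), wired w (tgt e) & ~~ connect (fin_adj w) (src e) (tgt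
    e)].

Lemma card_representative w y :
  #|[set x | representative w x & connect (fin_adj w) x y]| = wired w y :> nat.
Proof.
have [/existsP[x0 /andP[x0D x0y]]|nw] := boolP (wired w y); last first.
  apply: eq_card0 => x; rewrite inE;
    apply: contraNF nw => /andP[/andP[xD _] xy].
  by apply/existsP; exists x; rewrite xD.
have [x1 /andP[x1D x1y] x1P] :
    exists2 x1, (x1 \in D) && connect (fin_adj w) y x1 &
    [pick z in D | connect (fin_adj w) y z] = Some x1.
  case: pickP => [x1 x1P|/(_ x0)]; first by exists x1.
  by rewrite x0D fin_conn_sym x0y.
have eqp x : connect (fin_adj w) x y ->
    [pick z in D | connect (fin_adj w) x z] = Some x1.
  move=> xy; rewrite -x1P; apply: eq_pick => z /=; congr andb.
  exact: (same_connect (fin_conn_sym w) xy).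
rewrite (_ : [set x | _ & _] = [set x1]%SET) ?cards1//.
apply/setP => x; rewrite !inE; apply/idP/eqP => [/andP[/andP[xD]]|->].
  by move=> /eqP + /eqp => -> [].
have x1y' : connect (fin_adj w) x1 y by rewrite fin_conn_sym.
by rewrite /representative x1D (eqp _ x1y') eqxx.
Qed.

(* Summing over clusters instead of over their union counts an edge twice
   exactly when it joins two distinct wired clusters. *)
Lemma card_representative_touches w e :
  #|[set x | representative w x & touches w x e]| =
  ((wired w (src e) || wired w (tgt e)) + two_arms w e)%N.
Proof.
rewrite (_ : [set x | _ & _] = [set x | representative w x &
  connect (fin_adj w) x (src e)] :|: [set x | representative w x &
  connect (fin_adj w) x (tgt e)])%SET; last first.
  by apply/setP => x; rewrite !inE -andb_orr.
rewrite cardsU !card_representative /two_arms.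
have [st|nst] := boolP (connect (fin_adj w) (src e) (tgt e)).
  have -> : ([set x | representative w x & connect (fin_adj w) x (src e)] :&:
    [set x | representative w x & connect (fin_adj w) x (tgt e)])%SET =
    [set x | representative w x & connect (fin_adj w) x (src e)]%SET.
    apply/setP => x; rewrite !inE; case: (representative w x) => //=.
    rewrite -![connect _ x _]fin_conn_sym (same_connect (fin_conn_sym w) st).
    by rewrite andbb.
  rewrite card_representative addKn !andbF addn0.
  rewrite (_ : wired w (src e) = wired w (tgt e)) ?orbb//.
  apply: eq_existsb => x; congr andb; rewrite -![connect _ x _]fin_conn_sym.
  exact: (same_connect (fin_conn_sym w) st).
have -> : ([set x | representative w x & connect (fin_adj w) x (src e)] :&:
    [set x | representative w x & connect (fin_adj w) x (tgt e)])%SET =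
      finset.set0.
  apply/setP => x; rewrite !inE;
    apply: contraNF nst => /andP[/andP[_ xs] /andP[_ xt]].
  by rewrite (connect_trans _ xt)// fin_conn_sym.
by rewrite cards0 subn0; case: wired; case: wired.
Qed.

Lemma two_arms_closed w e : two_arms w e -> w e = false.
Proof.
case/and3P => _ _; apply: contraNF => we; apply: connect1.
by apply/existsP; exists e; rewrite we !eqxx.
Qed.

Definition toggle e w := [ffun f => if f == e then ~~ w f else w f].

Lemma toggleK e : involutive (toggle e).
Proof. by move=> w; apply/ffunP => f; rewrite !ffunE; case: eqP => _;
  rewrite ?negbK. Qed.

(** A path that uses [e] has already reached an end of [e] before crossing it, so the state of [e]
    does not decide whether the cluster of [x] reaches [e]. *)
Lemma touches_toggle e w x : touches (toggle e w) x e = touches w x e.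
Proof.
suff imp v : touches v x e -> touches (toggle e v) x e.
  by apply/idP/idP => [/imp|/imp//]; rewrite toggleK.
have step y : connect (fin_adj v) x y ->
    connect (fin_adj (toggle e v)) x y || touches (toggle e v) x e.
  move=> /connectP[s]; elim/last_ind: s y => [|s z IHs] y /=.
    by move=> _ ->; rewrite connect0.
  rewrite rcons_path last_rcons => /andP[ps szs] ->.
  case/orP: (IHs _ ps erefl) => [cs|->]; last by rewrite orbT.
  case/existsP: szs => f /andP[vf ends].
  have [fe|fe] := eqVneq f e.
    rewrite {}fe in ends; rewrite /touches.
    by case/orP: ends => /andP[/eqP-> /eqP->]; rewrite cs ?orbT.
  rewrite (connect_trans cs)//; apply: connect1; apply/existsP; exists f.
  by rewrite ffunE (negbTE fe) vf.
case/orP => /step; rewrite /touches; case/orP => //.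
- by move=> ->.
- by move=> ->; rewrite orbT.
Qed.

Lemma wired_toggle e w :
  wired (toggle e w) (src e) || wired (toggle e w) (tgt e) =
  wired w (src e) || wired w (tgt e).
Proof.
have E1 v : wired v (src e) || wired v (tgt e) = [exists x in D, touches v x e].
  apply/idP/existsP => [/orP[]/existsP[x /andP[xD xe]]|[x /andP[xD /orP[]xe]]].
  - by exists x; rewrite xD /touches xe.
  - by exists x; rewrite xD /touches xe orbT.
  - by apply/orP; left; apply/existsP; exists x; rewrite xD.
  - by apply/orP; right; apply/existsP; exists x; rewrite xD.
by rewrite !E1; apply: eq_existsb => x; rewrite touches_toggle.
Qed.

(* Whether an endpoint of [e] is wired does not depend on the state of [e]. *)
Lemma sum_score_wired e :
  \sum_w weight p w * ((wired w (src e) || wired w (tgt e))%:R * score (w e)) =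
    0.
Proof.
(* Toggling [e] fixes the wired condition and the other edges, and changes the sign of
   [bern p b * score b], which is -1 for an open edge and 1 for a closed one. *)
set S := LHS; suff : S = - S by lra.
rewrite {1}/S (reindex_inj (inv_inj (toggleK e)))/= -sumrN.
apply: eq_bigr => w _; rewrite wired_toggle mulrCA [in RHS]mulrCA -mulrN.
congr (_ * _); rewrite /weight (bigD1 e)//= [in RHS](bigD1 e)//=.
rewrite [X in _ * X * _](eq_bigr (fun i => bern p (w i))); last first.
  by move=> i ie; rewrite ffunE (negbTE ie).
rewrite ffunE eqxx mulrAC [in RHS]mulrAC -mulNr; congr (_ * _).
rewrite /score /bern -/q.
by case: (w e) => /=; field; rewrite ?(gt_eqF p_gt0) ?(gt_eqF q_gt0).
Qed.

Lemma weight_ge0 w : 0 <= weight p w.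
Proof. by apply: prodr_ge0 => e _; rewrite /bern; case: (w e); apply: ltW. Qed.

Theorem sum_two_arms_le :
  \sum_w weight p w * (\sum_e (two_arms w e)%:R) <=
  q * (#|D|%:R / delta + 2 * tilt_cost * delta * #|E|%:R).
Proof.
rewrite -ler_pdivrMl//.
(* Pointwise bound. The last sum is the score of the union of the wired clusters, whose mean
   vanishes by [sum_score_wired]. *)
have key w : q^-1 * (\sum_e (two_arms w e)%:R) <=
    \sum_(x in D) tilted_weight w x / delta + 2 * tilt_cost * delta * #|E|%:R
    - \sum_e (wired w (src e) || wired w (tgt e))%:R * score (w e).
  rewrite lerBrDr mulr_sumr -big_split/=.
  have -> : \sum_e (q^-1 * (two_arms w e)%:R +
      (wired w (src e) || wired w (tgt e))%:R * score (w e)) =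
      \sum_(x | representative w x) \sum_(e | touches w x e) score (w e).
    rewrite (exchange_big_dep xpredT)//=; apply: eq_bigr => e _.
    rewrite (eq_bigl (fun x => x \in [set x | representative w x & touches w x
      e]%SET));
      last by move=> x; rewrite inE.
    rewrite sumr_const -[score _ *+ _]mulr_natl card_representative_touches
      natrD mulrDl addrC.
    congr (_ + _); case: (boolP (two_arms w e)) => [/two_arms_closed->|_].
      by rewrite mulr1 mul1r.
    by rewrite mulr0 mul0r.
  apply: (@le_trans _ _ (\sum_(x | representative w x)
    (tilted_weight w x / delta + tilt_cost * delta * #|touches w x|%:R))).
    by apply: ler_sum => x _; exact: sum_score_le.
  (* Nonnegativity lets the sum over representatives grow to all of [D], a set that does not depend
     on [w]. *)
  have tw0 x : 0 <= tilted_weight w x.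
    apply: prodr_ge0 => e _; case: ifP => // _.
    by apply: le_trans (tilt_ge _); rewrite expR_ge0.
  rewrite big_split/=; apply: lerD.
    rewrite big_mkcond [leRHS]big_mkcond/=; apply: ler_sum => x _.
    rewrite /representative; case: (x \in D) => //=; case: ifP => // _.
    by rewrite divr_ge0// ltW.
  rewrite -mulr_sumr.
  have -> : 2 * tilt_cost * delta * #|E|%:R = tilt_cost * delta * (2 * #|E|%:R)
    by ring.
  apply: ler_wpM2l.
    by rewrite mulr_ge0 ?(ltW delta_gt0)// /tilt_cost addr_ge0 ?divr_ge0
      ?exprn_ge0 ?ltW.
  rewrite -natr_sum -natrM ler_nat.
  rewrite (eq_bigr (fun x => \sum_(e | touches w x e) 1)%N); last first.
    by move=> x _; rewrite sum1_card.
  (* An edge touches at most two wired clusters, whence the factor 2. *)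
  rewrite (exchange_big_dep xpredT)//= mulnC -sum_nat_const;
    apply: leq_sum => e _.
  rewrite (eq_bigl (fun x => x \in [set x | representative w x & touches w x
    e]%SET));
      last by move=> x; rewrite inE.
  rewrite sum1_card card_representative_touches.
  by case: (_ || _); case: two_arms.
rewrite mulr_sumr.
apply: (@le_trans _ _ (\sum_w weight p w * (\sum_(x in D) tilted_weight w x /
  delta +
    2 * tilt_cost * delta * #|E|%:R
    - \sum_e (wired w (src e) || wired w (tgt e))%:R * score (w e)))).
  apply: ler_sum => w _; rewrite mulrCA; apply: ler_wpM2l (key w).
  exact: weight_ge0.
rewrite (eq_bigr (fun w => (\sum_(x in D) weight p w * tilted_weight w x /
  delta +
    weight p w * (2 * tilt_cost * delta * #|E|%:R))
    - \sum_e weight p w * ((wired w (src e) || wired w (tgt e))%:R * score (w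
        e))));
    last first.
  move=> w _; rewrite mulrBr mulrDr !mulr_sumr; congr (_ + _ - _).
  by apply: eq_bigr => x _; rewrite mulrA.
rewrite sumrB exchange_big/= [X in _ - X]big1; last first.
  by move=> e _; exact: sum_score_wired.
rewrite subr0 big_split/= -mulr_suml sum_weight mul1r lerD2r.
rewrite exchange_big/= (eq_bigr (fun=> delta^-1)) ?sumr_const ?mulr_natl//.
by move=> x _; rewrite -mulr_suml sum_tilted_weight mul1r.
Qed.

End finite_percolation.

(** * Product spaces and Bernoulli percolation *)

Section product_space_facts.
Context (I : choiceType) (disp : measure_display) (T : measurableType disp).

Lemma measurable_coordinate i :
  measurable_fun setT (fun f : product_space I T => f i).
Proof.
move=> _ B mB; rewrite setTI; apply: sub_sigma_algebra.
by exists i, B.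
Qed.

Lemma measurable_to_product (disp' : measure_display) (X : measurableType disp')
    (g : X -> product_space I T) :
  (forall i, measurable_fun setT (fun x => g x i)) -> measurable_fun setT g.
Proof.
move=> mg; apply: (@measurability _ _ X (product_space I T) setT g
  (@coordinate_sets I disp T)) => //.
move=> _ [_ [i [B [mB ->]]] <-]; rewrite setTI -[X in measurable X]setTI.
exact: mg.
Qed.

Definition cylinder (B : I -> set T) : set (product_space I T) :=
  [set f | forall i, B i (f i)].

Definition cylinders : set (set (product_space I T)) :=
  [set cylinder B | B in [set B | (forall i, measurable (B i)) /\
    exists F : {fset I}, forall i, i \notin F -> B i = setT]].

Lemma cylinderE (B : I -> set T) (F : {fset I}) :
  (forall i, i \notin F -> B i = setT) ->
  cylinder B = \bigcap_(i in [set` F]) (fun f : product_space I T => f i) @^-1`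
    B i.
Proof.
move=> BF; apply/seteqP; split => f Bf i; first by move=> _; exact: Bf.
have [iF|/BF->//] := boolP (i \in F); exact: Bf.
Qed.

Lemma measurable_cylinders : cylinders `<=` measurable.
Proof.
move=> _ [B [mB [F BF]] <-]; rewrite (cylinderE BF).
apply: fin_bigcap_measurable => // i _; rewrite -[X in measurable X]setTI.
exact: measurable_coordinate.
Qed.

Lemma setI_closed_cylinders : setI_closed cylinders.
Proof.
move=> _ _ [B [mB [F BF]] <-] [B' [mB' [F' BF']] <-].
exists (fun i => B i `&` B' i).
  split; first by move=> i; exact: measurableI.
  exists (F `|` F')%fset => i; rewrite inE negb_or => /andP[iF iF'].
  by rewrite BF ?BF' ?setTI.
apply/seteqP; split => f.
- by move=> BB; split => i; case: (BB i).
- by move=> [Bf Bf'] i; split.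
Qed.

(** Cylinders form a pi-system that generates the product sigma-algebra. Insertion tolerance,
    translation invariance and uniqueness of the color measure all reduce to cylinders through this
    lemma. *)
Lemma product_measure_unique (R : realType)
    (m1 m2 : {measure set (product_space I T) -> \bar R}) :
  (m1 setT < +oo)%E -> (forall C, cylinders C -> m1 C = m2 C) ->
  forall A, measurable A -> m1 A = m2 A.
Proof.
move=> m1fin m12 A mA.
have cylT : cylinders setT.
  exists (fun=> setT); first by split => //; exists fset0.
  by apply/seteqP; split.
apply: (measure_unique cylinders (fun=> setT)) => //.
- apply/seteqP; split; last first.
    exact: (smallest_sub (sigma_algebra_measurable _) measurable_cylinders).
  move=> B; apply: smallest_sub => // _ [i [B' [mB' ->]]].
  apply: sub_sigma_algebra.
  exists (fun j => if j == i then B' else setT).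
    split; first by move=> j; case: ifP.
    by exists [fset i]%fset => j; rewrite inE => /negbTE->.
  apply/seteqP; split => f /=.
  - by move=> /(_ i); rewrite eqxx.
  - by move=> Bf j; case: eqP => // ->.
- exact: setI_closed_cylinders.
- by rewrite -subTset => x _; exists 0%N.
Qed.

End product_space_facts.

Section independence.
Context (disp disp' : measure_display) (Omega : measurableType disp)
  (T : measurableType disp') (R : realType) (P : {measure set Omega -> \bar R}).

Lemma independent_family_reindex (I J : choiceType) (h : J -> I)
    (X : I -> Omega -> T) (S : set I) (S' : set J) :
  injective h -> (forall j, S' j -> S (h j)) ->
  independent_family P S X -> independent_family P S' (X \o h).
Proof.
move=> hi S'S indX F B FS' mB.
pose B' i := if pselect (exists j, (j \in F) && (h j == i)) is left p
  then B (xchoose p) else setT.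
have B'h j : j \in F -> B' (h j) = B j.
  move=> jF; rewrite /B'; case: pselect => [p|[]]; last first.
    by exists j; rewrite jF eqxx.
  by have /andP[_ /eqP/hi ->] := xchooseP p.
have /indX : [set` [fset h j | j in F]%fset] `<=` S.
  by move=> _ /= /imfsetP[j /= jF ->]; apply/S'S/FS'.
move=> /(_ B'); rewrite big_imfset/=; last by move=> ? ? _ _; exact: hi.
under eq_big_seq => j jF do rewrite (B'h _ jF).
move=> <-; last by move=> _ /imfsetP[j /= jF ->]; rewrite B'h//; exact: mB.
congr (P _); apply/seteqP; split => w Bw.
- by move=> _ /= /imfsetP[j /= jF ->]; rewrite B'h//; exact: Bw.
- move=> j jF; rewrite /= -(B'h _ jF); apply: (Bw (h j)) => /=.
  by apply/imfsetP; exists j.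
Qed.

End independence.

Lemma big_fset_disjointU (S : Type) (idx : S) (op : Monoid.com_law idx)
    (I : choiceType) (A B : {fset I}) (F : I -> S) : [disjoint A & B]%fset ->
  \big[op/idx]_(i <- (A `|` B)%fset) F i =
  op (\big[op/idx]_(i <- A) F i) (\big[op/idx]_(i <- B) F i).
Proof.
move=> AB; rewrite -big_cat; apply: perm_big; apply: uniq_perm.
- exact: fset_uniq.
- rewrite cat_uniq !fset_uniq andbT/=; apply/hasPn => i /= iB.
  by move: AB; rewrite fdisjoint_sym => /fdisjointP; apply.
- by move=> i; rewrite mem_cat inE.
Qed.

Lemma measure_bigcup_finType (disp : measure_display) (Omega : measurableType
  disp)
    (R : realType) (P : {measure set Omega -> \bar R}) (K : finType)
    (Q : pred K) (F : K -> set Omega) :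
  (forall k, Q k -> measurable (F k)) -> trivIset setT F ->
  P (\bigcup_(k in [set k | Q k]) F k) = (\sum_(k | Q k) P (F k))%E.
Proof.
move=> mF tF.
rewrite (_ : [set k | Q k] = [set` [seq k <- index_enum K | Q k]]); last first.
  by apply/seteqP; split => k /=; rewrite mem_filter mem_index_enum andbT.
rewrite measure_fin_bigcup//.
- by rewrite -fsbig_seq ?filter_uniq ?index_enum_uniq// big_filter.
- exact: sub_trivIset tF.
- by move=> k /=; rewrite mem_filter => /andP[/mF].
Qed.

Section bernoulli.
Context (R : realType) (d : nat) (p : R) (mu : probability (subgraph d) R).
Hypotheses (p01 : 0 < p < 1) (muB : bernoulli_percolation p mu).
Implicit Types (e : edge d) (F : {fset edge d}) (G : subgraph d).

Lemma bernoulli_edge e (B : set bool) :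
  mu [set G : subgraph d | B (G e)] = (\sum_(b <- [:: true;
    false] | b \in B) bern p b)%:E.
Proof.
have mE b : measurable [set G : subgraph d | G e = b].
  rewrite (_ : mkset _ = (fun G : subgraph d => G e) @^-1` [set b])//.
  rewrite -[X in measurable X]setTI; exact: measurable_coordinate.
have muT : mu [set G : subgraph d | G e = true] = p%:E by rewrite -(muB.1 e).
have muF : mu [set G : subgraph d | G e = false] = (1 - p)%:E.
  rewrite (_ : [set G : subgraph d | _] = ~` [set G : subgraph d | G e = true]).
    by rewrite probability_setC// muT.
  by apply/seteqP; split => G /=; case: (G e).
rewrite !big_cons big_nil; case: ifPn => Bt; case: ifPn => Bf;
  move: Bt Bf; rewrite ?inE ?notin_setE => Bt Bf.
- rewrite /bern addr0 addrC subrK -(probability_setT mu); congr (mu _).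
  by apply/seteqP; split => G //= _; case: (G e).
- rewrite addr0 -muT; congr (mu _); apply/seteqP; split => G /= BG.
    by case: (G e) BG.
  by rewrite BG.
- rewrite addr0 -muF; congr (mu _); apply/seteqP; split => G /= BG.
    by case: (G e) BG.
  by rewrite BG.
- rewrite [X in mu X](_ : _ = set0) ?measure0//; apply/seteqP; split => G //=.
  by case: (G e).
Qed.

Lemma bernoulli_cylinder F (B : edge d -> set bool) :
  (forall e, e \notin F -> B e = setT) ->
  mu (cylinder B) = (\prod_(e <- F) mu [set G : subgraph d | B e (G e)])%E.
Proof. by move=> /cylinderE ->; apply: (muB.2 F B) => //. Qed.

Definition restr F (G : subgraph d) : {ffun F -> bool} := [ffun e : F => G (val
  e)].

Lemma bernoulli_atom F (w : {ffun F -> bool}) :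
  mu [set G : subgraph d | restr F G = w] = (weight p w)%:E.
Proof.
pose B e : set bool := if insub e is Some f then [set w f] else setT.
have BE (f : F) : B (val f) = [set w f] by rewrite /B valK.
rewrite (_ : [set G | _] = cylinder B); last first.
  apply/seteqP; split => G /=.
  - move=> Gw e; rewrite /B; case: insubP => // f _ <- /=.
    by rewrite -Gw ffunE.
  - by move=> BG; apply/ffunP => f; rewrite ffunE; move: (BG (val f));
      rewrite BE.
rewrite (@bernoulli_cylinder F); last first.
  by move=> e eF; rewrite /B insubN.
rewrite big_seq_fsetE/= /weight -prodEFin; apply: eq_bigr => f _.
have mem_w b : (b \in [set w f]) = (b == w f) by apply/idP/eqP; rewrite inE.
rewrite BE bernoulli_edge !big_cons big_nil !mem_w; congr EFin.
by case: (w f); rewrite /= ?addr0.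
Qed.

Lemma measurable_atom F (w : {ffun F -> bool}) :
  measurable [set G : subgraph d | restr F G = w].
Proof.
rewrite (_ : [set G | _] = \bigcap_(f in [set: F])
    (fun G : subgraph d => G (val f)) @^-1` [set w f]).
  apply: fin_bigcap_measurable => // f _; rewrite -[X in measurable X]setTI.
  exact: measurable_coordinate.
apply/seteqP; split => G /=; first by move=> <- f _ /=; rewrite ffunE.
by move=> Gw; apply/ffunP => f; rewrite ffunE; exact: Gw.
Qed.

Lemma restr_bigcup F (Q : pred {ffun F -> bool}) :
  [set G : subgraph d | Q (restr F G)] =
  \bigcup_(w in [set w | Q w]) [set G : subgraph d | restr F G = w].
Proof.
apply/seteqP; split => G /=; first by move=> QG; exists (restr F G).
by move=> [w /= Qw ->].
Qed.

Lemma measurable_restr F (Q : pred {ffun F -> bool}) :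
  measurable [set G : subgraph d | Q (restr F G)].
Proof.
rewrite restr_bigcup; apply: fin_bigcup_measurable => // w _.
exact: measurable_atom.
Qed.

(** Turns the probability of an event seen in a finite window into a finite weighted sum, the form
    in which [sum_two_arms_le] is stated. *)
Lemma bernoulli_restr F (Q : pred {ffun F -> bool}) :
  mu [set G : subgraph d | Q (restr F G)] = (\sum_(w | Q w) weight p w)%:E.
Proof.
rewrite restr_bigcup measure_bigcup_finType.
- by rewrite -sumEFin; apply: eq_bigr => w _; exact: bernoulli_atom.
- by move=> w _; exact: measurable_atom.
- by move=> w v _ _ [G [/= <- <-]].
Qed.

Definition depends_on F (A : set (subgraph d)) := forall G G' : subgraph d,
  (forall e, e \in F -> G e = G' e) -> A G -> A G'.

Lemma depends_onP F A : depends_on F A ->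
  exists Q : pred {ffun F -> bool}, A = [set G : subgraph d | Q (restr F G)].
Proof.
move=> FA.
exists [pred w | `[< exists2 G' : subgraph d, A G' & restr F G' = w >]].
apply/seteqP; split => G /=.
- by move=> AG; apply/asboolP; exists G.
- move=> /asboolP[G' AG' GG']; apply: FA AG' => e eF.
  by have := congr1 (fun w : {ffun F -> bool} => w [` eF]%fset) GG';
    rewrite !ffunE.
Qed.

Lemma bernoulli_atomI F1 F2 (w1 : {ffun F1 -> bool}) (w2 : {ffun F2 -> bool}) :
  [disjoint F1 & F2]%fset ->
  mu ([set G : subgraph d | restr F1 G = w1] `&`
      [set G : subgraph d | restr F2 G = w2]) =
  (weight p w1 * weight p w2)%:E.
Proof.
move=> F12.
pose B1 e : set bool := if insub e is Some f then [set w1 f] else setT.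
pose B2 e : set bool := if insub e is Some f then [set w2 f] else setT.
pose B e := B1 e `&` B2 e.
have cyl F (w : {ffun F -> bool}) : [set G : subgraph d | restr F G = w] =
    cylinder (fun e => if insub e is Some f then [set w f] else setT).
  apply/seteqP; split => G /=.
  - move=> Gw e; case: insubP => // f _ <- /=; by rewrite -Gw ffunE.
  - by move=> BG; apply/ffunP => f; rewrite ffunE; move: (BG (val f));
      rewrite valK.
have -> : [set G : subgraph d | restr F1 G = w1] `&`
    [set G : subgraph d | restr F2 G = w2] = cylinder B.
  rewrite !cyl; apply/seteqP; split => G /=.
move=> [G1 G2] e; split; [exact: (G1 e)|exact: (G2 e)].
  by move=> GB; split => e; [exact: (GB e).1|exact: (GB e).2].
have BF : forall e, e \notin (F1 `|` F2)%fset -> B e = setT.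
  by move=> e; rewrite inE negb_or /B /B1 /B2 => /andP[e1 e2];
    rewrite !insubN// setTI.
rewrite (bernoulli_cylinder BF) big_fset_disjointU//= EFinM -!bernoulli_atom
  !cyl.
rewrite (@bernoulli_cylinder F1); last by move=> e eF; rewrite insubN.
rewrite (@bernoulli_cylinder F2); last by move=> e eF; rewrite insubN.
congr (_ * _)%E; rewrite big_seq [RHS]big_seq; apply: eq_bigr => e eF.
- by rewrite /B (_ : B2 e = setT) ?setIT// /B2 insubN// (fdisjointP F12).
- rewrite /B (_ : B1 e = setT) ?setTI// /B1 insubN//.
  by move: F12; rewrite fdisjoint_sym => /fdisjointP; apply.
Qed.

(** Independence is assumed for single edges, that is for product events; both events are cut into
    atoms, where it applies. *)
Lemma bernoulli_indep F1 F2 A1 A2 : [disjoint F1 & F2]%fset ->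
  depends_on F1 A1 -> depends_on F2 A2 -> mu (A1 `&` A2) = (mu A1 * mu A2)%E.
Proof.
move=> F12 /depends_onP[Q1 ->] /depends_onP[Q2 ->].
rewrite !bernoulli_restr -EFinM.
transitivity (mu (\bigcup_(w in [set w : {ffun F1 -> bool} * {ffun F2 -> bool}
    | Q1 w.1 && Q2 w.2]) ([set G : subgraph d | restr F1 G = w.1] `&`
   [set G : subgraph d | restr F2 G = w.2]))).
  congr (mu _); apply/seteqP; split => G /=.
  - by move=> [G1 G2]; exists (restr F1 G, restr F2 G) => //=; apply/andP.
  - by move=> [[w1 w2] /andP[/= Q1w Q2w] [-> ->]].
rewrite measure_bigcup_finType.
- rewrite (eq_bigr (fun w => (weight p w.1 * weight p w.2)%:E)); last first.
    by move=> w _; exact: bernoulli_atomI.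
  rewrite sumEFin -(pair_big_dep Q1 (fun=> Q2) (fun w1 w2 => weight p w1 *
    weight p w2))/=.
  by rewrite mulr_suml; congr EFin; apply: eq_bigr => w1 _; rewrite mulr_sumr.
- by move=> w _; apply: measurableI; exact: measurable_atom.
- by move=> [w1 w2] [v1 v2] _ _ [G [[/= <- <-] [<- <-]]].
Qed.

Definition insert e (G : subgraph d) : subgraph d := fun f => (f == e) || G f.

Lemma measurable_insert e : measurable_fun setT (insert e).
Proof.
apply: measurable_to_product => f; rewrite /insert; case: eqP => _ /=.
  exact: measurable_cst.
exact: measurable_coordinate.
Qed.

(** Given that [e] is open, the other edges keep their law. Hence [p] times the law of [insert e G]
    is [mu] restricted to the configurations where [e] is open, and [p] is positive. *)
Lemma insertion_tolerance e A : measurable A -> mu A = 0%E ->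
  mu (insert e @^-1` A) = 0%E.
Proof.
move=> mA muA.
have mGe : measurable [set G : subgraph d | G e].
  rewrite (_ : [set G : subgraph d | G e] = (fun G : subgraph d => G e) @^-1`
    [set true]).
    rewrite -[X in measurable X]setTI; exact: measurable_coordinate.
  by apply/seteqP; split.
have p0 : 0 <= p by case/andP: p01 => /ltW.
pose m1 : {measure set (subgraph d) -> \bar R} :=
  mscale (NngNum p0) (image_measure mu (measurable_insert e)).
have m1E C : m1 C = (p%:E * mu (insert e @^-1` C))%E by [].
suff : m1 A = mrestr mu mGe A.
  rewrite /mrestr/= (_ : mu (A `&` _) = 0%E); last first.
    apply/eqP; rewrite -measure_le0 -muA le_measure// inE//.
    exact: measurableI.
  rewrite m1E.
  by move=> /eqP; rewrite mule_eq0 eqe gt_eqF ?(andP p01).1//= => /eqP.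
apply: product_measure_unique mA.
  by rewrite m1E [X in (_ * X)%E](probability_setT mu) mule1 ltry.
move=> _ [B [mB [F BF]] <-].
(* [Bl] frees the coordinate [e], which insertion has set to [true]; [Br] requires it to be open. If
   [B e] contains [true], the probabilities of the two cylinders differ by the factor [p]. *)
pose Bl f : set bool := if f == e then setT else B f.
pose Br f : set bool := if f == e then [set true] `&` B f else B f.
have BlF f : f \notin (F `\ e)%fset -> Bl f = setT.
  by rewrite !inE negb_and negbK /Bl; case: eqP => //= _ /BF.
have BrF f : f \notin (e |` (F `\ e))%fset -> Br f = setT.
  by rewrite !inE /Br; case: eqP => //= _ /BF.
rewrite m1E -[RHS]/(mu (cylinder B `&` [set G : subgraph d | G e])).
have -> : cylinder B `&` [set G : subgraph d | G e] = cylinder Br.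
  apply/seteqP; split => G /=.
    by move=> [BG Ge] f; rewrite /Br; case: eqP => [->|_]; [split;
      [exact: Ge|exact: BG]|exact: BG].
  move=> BG; split; last by have := BG e; rewrite /Br eqxx => -[].
  by move=> f; have := BG f; rewrite /Br; case: eqP => // _ [].
have [Be|Be] := pselect (B e true); last first.
  rewrite (_ : insert e @^-1` _ = set0) ?measure0 ?mule0; last first.
    apply/seteqP; split => G //= BG; apply: Be.
    by have := BG e; rewrite /insert eqxx.
  rewrite (_ : cylinder _ = set0) ?measure0//.
  apply/seteqP; split => G //= BG; apply: Be.
  by have := BG e; rewrite /Br eqxx => -[->].
have -> : insert e @^-1` cylinder B = cylinder Bl.
  apply/seteqP; split => G /= BG f; have := BG f; rewrite /insert /Bl.
    by case: eqP.
  by case: eqP => // ->.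
rewrite (bernoulli_cylinder BlF) (bernoulli_cylinder BrF).
rewrite big_fsetU1 ?inE ?eqxx//=; congr (_ * _)%E.
  rewrite -(muB.1 e); congr (mu _); apply/seteqP; split => G /=.
    by rewrite /Br eqxx => Ge; split=> //; rewrite Ge.
  by rewrite /Br eqxx => -[].
rewrite big_seq [RHS]big_seq; apply: eq_bigr => f;
  rewrite !inE => /andP[/negbTE fe _].
by rewrite /Bl /Br fe.
Qed.

End bernoulli.

(** * Boxes, edges and clusters *)

Section boxes.
Context (d : nat).
Implicit Types (x y z : vertex d) (n m : nat).

Lemma boxD n m x y : box d n x -> box d m y -> box d (n + m) (x + y).
Proof.
move=> xn ym i; rewrite ffunE PoszD.
by apply: le_trans (ler_normD _ _) _; apply: lerD; [exact: xn|exact: ym].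
Qed.

Lemma boxN n x : box d n (- x) <-> box d n x.
Proof. by split => xn i; have := xn i; rewrite ffunE normrN. Qed.

Lemma box_le n m : (n <= m)%N -> box d n `<=` box d m.
Proof. by move=> nm x xn i; apply: le_trans (xn i) _; rewrite lez_nat. Qed.

Lemma box0 n : box d n 0.
Proof. by move=> i; rewrite ffunE normr0. Qed.

Lemma box_exists x : exists n, box d n x.
Proof.
exists (\max_(i < d) `|x i|%N)%N => i.
by rewrite -abszE lez_nat (leq_bigmax i).
Qed.

Definition box_point n (k : {ffun 'I_d -> 'I_(n.*2.+1)}) : vertex d :=
  [ffun i => (k i)%:Z - n%:Z].

Lemma box_point_inj n : injective (@box_point n).
Proof.
move=> k k' /ffunP kk; apply/ffunP => i; apply: val_inj => /=.
by have := kk i; rewrite !ffunE; lia.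
Qed.

Lemma range_box_point n : box d n = range (@box_point n).
Proof.
apply/seteqP; split => x /=; last first.
  by move=> [k _ <-] i; rewrite ffunE; have := ltn_ord (k i); lia.
move=> xn.
have xb i : (`|(x i + n%:Z)%R|%N < n.*2.+1)%N by have := xn i; lia.
exists [ffun i => Ordinal (xb i)] => //.
by apply/ffunP => i; rewrite !ffunE /=; have := xn i; lia.
Qed.

Lemma finite_box n : finite_set (box d n).
Proof. by rewrite range_box_point; exact: finite_image. Qed.

Lemma mem_box n x : (x \in fset_set (box d n)) = `[< box d n x >].
Proof.
rewrite in_fset_set; last exact: finite_box.
by apply/idP/asboolP; rewrite inE.
Qed.

Lemma card_box n : #|` fset_set (box d n)| = (n.*2.+1 ^ d)%N.
Proof.
rewrite (_ : fset_set _ = [fset box_point k | k in {: {ffun 'I_d ->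
  'I_(n.*2.+1)}}]%fset).
  by rewrite card_imfset/=;
    [rewrite -cardE card_ffun !card_ord|exact: box_point_inj].
apply/fsetP => x; rewrite mem_box range_box_point; apply/asboolP/imfsetP => /=.
  by move=> [k _ <-]; exists k.
by move=> [k _ ->]; exists k.
Qed.

Definition tbox z n : set (vertex d) := [set x | box d n (x - z)].

Lemma finite_tbox z n : finite_set (tbox z n).
Proof.
apply: (@sub_finite_set _ _ [set x + z | x in box d n]).
  by move=> x xn; exists (x - z) => //; rewrite subrK.
exact/finite_image/finite_box.
Qed.

End boxes.

Section edges.
Context (d : nat).
Implicit Types (x y z : vertex d) (e : edge d) (G : subgraph d).

Lemma edge_ends e : exists x y, val e = [fset x;
  y]%fset /\ \sum_(i < d) `|x i - y i| = 1.
Proof. by have := valP e; rewrite inE. Qed.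

Lemma unit_step_box x y : \sum_(i < d) `|x i - y i| = 1 -> box d 1 (x - y).
Proof.
move=> xy1 i; rewrite !ffunE -[1%:Z]/(1 : int) -xy1 (bigD1 i)//= lerDl.
by apply: sumr_ge0 => j _.
Qed.

Lemma edge_ends_box e u v : val e = [fset u; v]%fset -> box d 1 (u - v).
Proof.
have [x [y [-> xy1]]] := edge_ends e => /fsetP exy.
have b1 := unit_step_box xy1.
have b2 : box d 1 (y - x) by rewrite -opprB; exact/boxN.
have : u \in [fset x; y]%fset by rewrite exy !inE eqxx.
have : v \in [fset x; y]%fset by rewrite exy !inE eqxx orbT.
rewrite !inE => /orP[]/eqP-> /orP[]/eqP->//; rewrite subrr; exact: box0.
Qed.

Lemma translated_edge z e :
  lattice_edges d [fset (x + z)%R | x in val e]%fset.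
Proof.
have [x [y [-> xy1]]] := edge_ends e.
exists (x + z), (y + z); split.
  apply/fsetP => u; rewrite !inE; apply/imfsetP/orP => /=.
    move=> [v]; rewrite !inE => /orP[]/eqP-> ->; first by left.
    by right.
  by move=> [/eqP->|/eqP->]; [exists x|exists y]; rewrite // !inE eqxx ?orbT.
by rewrite -xy1; apply: eq_bigr => i _;
  rewrite !ffunE opprD addrACA subrr addr0.
Qed.

Definition translate_edge z e : edge d := SigSub (mem_set (translated_edge z
  e)).

Lemma translate_edgeE z e x y :
  val (translate_edge z e) = [fset (x + z)%R;
    (y + z)%R]%fset <-> val e = [fset x; y]%fset.
Proof.
rewrite /=; split => [exy|->]; last first.
  apply/fsetP => u; rewrite !inE; apply/imfsetP/orP => /=.
    move=> [v]; rewrite !inE => /orP[]/eqP-> ->; first by left.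
    by right.
  by move=> [/eqP->|/eqP->]; [exists x|exists y]; rewrite // !inE eqxx ?orbT.
apply/fsetP => u; have /fsetP/(_ (u + z)) := exy.
rewrite (@mem_imfset _ _ _ (fun v : vertex d => v + z))/=; last exact: addIr.
by rewrite !inE !(inj_eq (addIr z)).
Qed.

Lemma translate_edge_inj z : injective (translate_edge z).
Proof.
move=> e f ef; apply: val_inj; have [x [y [exy _]]] := edge_ends e.
rewrite exy; apply/esym/(translate_edgeE z).
by rewrite -ef; apply/translate_edgeE.
Qed.

Lemma translate_edgeK z e : translate_edge z (translate_edge (- z) e) = e.
Proof.
have [x [y [exy _]]] := edge_ends e.
apply: val_inj; rewrite exy -[in RHS](subrK z x) -[in RHS](subrK z y).
by apply/translate_edgeE/translate_edgeE.
Qed.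

Definition translate z G : subgraph d := fun e => G (translate_edge z e).

Lemma measurable_translate z : measurable_fun setT (translate z).
Proof. by apply: measurable_to_product => e; exact: measurable_coordinate. Qed.

Definition edges_in (S : set (vertex d)) : {fset edge d} :=
  fset_set [set e : edge d | forall x, x \in val e -> S x].

Lemma finite_edges_in (S : set (vertex d)) : finite_set S ->
  finite_set [set e : edge d | forall x, x \in val e -> S x].
Proof.
move=> finS.
have finP : finite_set [set` fpowerset (fset_set S)] by exact: finite_fset.
have := @finite_preimage _ _ [set` fpowerset (fset_set S)] (val : edge d -> _)
  _ finP.
move=> /(_ (fun e f _ _ ef => val_inj ef)).
apply: sub_finite_set => e eS /=; rewrite fpowersetE; apply/fsubsetP => x xe.
by rewrite in_fset_set// inE; exact: eS.
Qed.

Lemma mem_edges_in (S : set (vertex d)) e : finite_set S ->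
  reflect (forall x, x \in val e -> S x) (e \in edges_in S).
Proof.
move=> finS; rewrite in_fset_set; last exact: finite_edges_in.
by apply: (iffP idP); rewrite inE.
Qed.

Lemma edges_in_disjoint (S S' : set (vertex d)) : finite_set S -> finite_set S'
  ->
  S `&` S' = set0 -> [disjoint edges_in S & edges_in S']%fset.
Proof.
move=> finS finS' SS'; apply/fdisjointP => e /(mem_edges_in _ finS) eS.
apply/negP => /(mem_edges_in _ finS') eS'.
have [x [y [exy _]]] := edge_ends e.
have xe : x \in val e by rewrite exy !inE eqxx.
suff : (S `&` S') x by rewrite SS'.
by split; [exact: eS|exact: eS'].
Qed.

End edges.

Section cluster_facts.
Context (d : nat).
Implicit Types (x y z u v : vertex d) (e : edge d) (G : subgraph d).

Lemma adjacent_sym G x y : adjacent G x y -> adjacent G y x.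
Proof. by move=> [e [exy Ge]]; exists e; rewrite fsetUC. Qed.

Lemma adjacent_box G x y : adjacent G x y -> box d 1 (x - y).
Proof. by move=> [e [/edge_ends_box]]. Qed.

Lemma cluster_refl G x : cluster G x x.
Proof. by exists [::]. Qed.

Lemma cluster_step G x y z : cluster G x y -> adjacent G y z -> cluster G x z.
Proof.
move=> [s [ps ls]] yz; exists (rcons s z); split; last by rewrite last_rcons.
by rewrite rcons_path ps /= ls; apply/asboolP.
Qed.

Lemma cluster_ind G x (P : vertex d -> Prop) : P x ->
  (forall u v, cluster G x u -> P u -> adjacent G u v -> P v) ->
  forall y, cluster G x y -> P y.
Proof.
move=> Px step y [s [ps <-]].
elim/last_ind: s ps => //= s z IHs;
  rewrite rcons_path last_rcons => /andP[ps /asboolP zs].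
by apply: step zs; [exists s|exact: IHs].
Qed.

Lemma cluster_trans G x y z : cluster G x y -> cluster G y z -> cluster G x z.
Proof.
move=> xy; apply: (@cluster_ind G y (cluster G x)) => // u v _;
  exact: cluster_step.
Qed.

Lemma cluster_sym G x y : cluster G x y -> cluster G y x.
Proof.
apply: (@cluster_ind G x (cluster G ^~ x)); first exact: cluster_refl.
move=> u v _ ux uv; apply: cluster_trans ux.
exact: cluster_step (cluster_refl _ _) (adjacent_sym uv).
Qed.

Lemma cluster_eq G x y : cluster G x y -> cluster G x = cluster G y.
Proof.
move=> xy; apply/seteqP; split => z; last exact: cluster_trans.
by apply: cluster_trans; exact: cluster_sym.
Qed.

Lemma adjacent_translate z G x y :
  adjacent (translate z G) x y <-> adjacent G (x + z) (y + z).
Proof.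
split=> [[e [exy Ge]]|[e [exy Ge]]].
  by exists (translate_edge z e); split=> //; exact/translate_edgeE.
exists (translate_edge (- z) e); split;
  last by rewrite /translate translate_edgeK.
by apply/(translate_edgeE z); rewrite translate_edgeK.
Qed.

Lemma cluster_translate z G x y :
  cluster (translate z G) x y <-> cluster G (x + z) (y + z).
Proof.
split.
  apply: (@cluster_ind (translate z G) x (fun w => cluster G (x + z) (w + z)));
    first exact: cluster_refl.
  by move=> u v _ xu /adjacent_translate; exact: cluster_step.
move=> xy; rewrite -[y](addrK z).
apply: (@cluster_ind G (x + z) (fun w => cluster (translate z G) x (w - z))) xy.
  by rewrite addrK; exact: cluster_refl.
move=> u v _ xu uv; apply: (cluster_step xu); apply/adjacent_translate.
by rewrite !subrK.
Qed.

Lemma measurable_edge_open e : measurable [set G : subgraph d | G e].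
Proof.
rewrite (_ : [set G : subgraph d | G e] = (fun G : subgraph d => G e) @^-1`
  [set true]).
  rewrite -[X in measurable X]setTI; exact: measurable_coordinate.
by apply/seteqP; split.
Qed.

Lemma measurable_adjacent x y : measurable [set G : subgraph d | adjacent G x
  y].
Proof.
have [[e exy]|ne] := pselect (exists e : edge d, val e = [fset x; y]%fset).
  rewrite (_ : [set G | _] = [set G : subgraph d | G e]);
    first exact: measurable_edge_open.
  apply/seteqP; split => G /=; last by exists e.
  by move=> [f [fxy Gf]]; rewrite (_ : e = f)//; apply: val_inj; rewrite exy.
rewrite (_ : [set G | _] = set0)//; apply/seteqP; split => G //= [e [exy _]].
by apply: ne; exists e.
Qed.

Lemma measurable_cluster x y : measurable [set G : subgraph d | cluster G x y].
Proof.
have walk_meas s u : measurable [set G : subgraph d | walk G u s y].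
  elim: s u => [|v s IHs] u.
    have [->|uy] := eqVneq u y.
      by rewrite (_ : [set G | _] = setT)//; apply/seteqP; split.
    rewrite (_ : [set G | _] = set0)//; apply/seteqP; split => // G [_ /=] uy'.
    by rewrite uy' eqxx in uy.
  rewrite (_ : [set G | _] = [set G | adjacent G u v] `&` [set G | walk G v s
    y]).
    by apply: measurableI => //; exact: measurable_adjacent.
  apply/seteqP; split => G; rewrite /walk /=.
    by move=> [/andP[/asboolP uv ps] ls].
  by move=> [uv [ps ls]]; split => //; apply/andP; split => //; exact/asboolP.
rewrite (_ : [set G | _] = \bigcup_s [set G | walk G x s y]).
  by apply: countable_bigcupT_measurable; [exact: countableP|move=> s;
    exact: walk_meas].
by apply/seteqP; split => G /=; [move=> [s xy]; exists s|move=> [s _ xy];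
  exists s].
Qed.

(** Sets of vertices are finite when some box contains them. In this form infinity is a countable
    condition, which yields measurability, and it provides walks that leave any given window. *)
Lemma infinite_clusterP G x : infinite_set (cluster G x) <->
  forall n, exists2 y, cluster G x y & ~ tbox x n y.
Proof.
split=> [infx n|out finx].
  apply: contrapT => h; apply: infx; apply: sub_finite_set (finite_tbox x n).
  by move=> y xy; apply: contrapT => yn; apply: h; exists y.
have [n nP] : exists n, cluster G x `<=` tbox x n.
  pose r (y : vertex d) := xget 0%N [set n | box d n (y - x)].
  have rP y : box d (r y) (y - x) by apply: (xgetPex 0%N (box_exists (y - x))).
  exists (\max_(y <- fset_set (cluster G x)) r y)%N => y xy.
  apply: (box_le _ (rP y)); apply: (@leq_bigmax_seq _ _ xpredT r) => //.
  by rewrite in_fset_set// inE.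
by have [y xy] := out n; apply; exact: nP.
Qed.

Lemma measurable_cluster_sub x (S : set (vertex d)) :
  measurable [set G : subgraph d | cluster G x `<=` S].
Proof.
rewrite (_ : [set G | _] = ~` \bigcup_(y in ~` S) [set G | cluster G x y]).
  apply: measurableC; rewrite bigcup_mkcond.
  apply: countable_bigcupT_measurable; first exact: countableP.
  move=> y; by case: ifP => // _; exact: measurable_cluster.
apply/seteqP; split => G /=.
  by move=> xS [y /= yS xy]; apply: yS; exact: xS.
by move=> xS y xy; apply: contrapT => yS; apply: xS; exists y.
Qed.

Lemma measurable_infinite_cluster x :
  measurable [set G : subgraph d | infinite_set (cluster G x)].
Proof.
rewrite (_ : [set G | _] = \bigcap_n ~` [set G | cluster G x `<=` tbox x n]).
  apply: bigcapT_measurable => n; apply: measurableC.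
  exact: measurable_cluster_sub.
apply/seteqP; split => G /=.
  by move=> /infinite_clusterP out n _ /= sub; have [y /sub] := out n.
move=> out; apply/infinite_clusterP => n; apply: contrapT => h.
by apply: (out n I) => /= y xy; apply: contrapT => yn; apply: h; exists y.
Qed.

Lemma infinite_cluster_translate z G x :
  infinite_set (cluster (translate z G) x) <-> infinite_set (cluster G (x + z)).
Proof.
have E y n : tbox (x + z) n (y + z) = tbox x n y.
  by rewrite /tbox /= opprD addrACA subrr addr0.
split=> /infinite_clusterP out; apply/infinite_clusterP => n;
  have [y xy yn] := out n.
- by exists (y + z); [exact/cluster_translate|rewrite E].
- exists (y - z); last by rewrite -E subrK.
  by apply/cluster_translate; rewrite subrK.
Qed.

End cluster_facts.

(** * Uniqueness of the infinite cluster *)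

Lemma bernoulli_translate (R : realType) (d : nat) (p : R)
    (mu : probability (subgraph d) R) (muB : bernoulli_percolation p mu)
    (z : vertex d) (A : set (subgraph d)) : measurable A ->
  mu (translate z @^-1` A) = mu A.
Proof.
move=> mA; pose m1 := image_measure mu (@measurable_translate d z).
have m1E C : m1 C = mu (translate z @^-1` C) by [].
rewrite -m1E; apply: product_measure_unique mA.
  by rewrite m1E [X in (X < _)%E](probability_setT mu) ltry.
move=> _ [B [mB [F BF]] <-];
  rewrite m1E -[RHS]/(mu (cylinder B)) (bernoulli_cylinder muB BF).
rewrite (cylinderE BF) preimage_bigcap.
rewrite [LHS](independent_family_reindex (@translate_edge_inj d z) (fun _ =>
  id) muB.2)//.
apply: eq_bigr => e _; rewrite (bernoulli_edge muB e).
exact: (bernoulli_edge muB (translate_edge z e)).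
Qed.

Lemma fset2_inj (K : choiceType) (a b u v : K) : [fset a; b]%fset = [fset u;
  v]%fset ->
  (a = u /\ b = v) \/ (a = v /\ b = u).
Proof.
move=> /fsetP abuv.
have : a \in [fset u; v]%fset by rewrite -abuv !inE eqxx.
have : b \in [fset u; v]%fset by rewrite -abuv !inE eqxx orbT.
have : u \in [fset a; b]%fset by rewrite abuv !inE eqxx.
have : v \in [fset a; b]%fset by rewrite abuv !inE eqxx orbT.
rewrite !inE => va ua /orP[]/eqP bE /orP[]/eqP aE; subst a b.
- by move: va; rewrite orbb => /eqP->; left.
- by right.
- by left.
- by move: ua; rewrite orbb => /eqP->; left.
Qed.

(** * Finite windows of the lattice *)

Section finite_window.
Context (d : nat) (V : {fset vertex d}).
Implicit Types (G : subgraph d) (u v : V).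

Local Notation E := (edges_in [set` V]).

Lemma edges_in_ends (e : E) :
  exists uv : V * V, (val (val e) : {fset vertex d}) = [fset val uv.1;
    val uv.2]%fset.
Proof.
have [x [y [exy _]]] := edge_ends (val e).
have /mem_edges_in/(_ (valP e)) eV := @finite_fset _ V.
have xV : x \in V by apply: eV; rewrite exy !inE eqxx.
have yV : y \in V by apply: eV; rewrite exy !inE eqxx orbT.
by exists ([` xV]%fset, [` yV]%fset).
Qed.

Definition edge_src (e : E) : V := (sval (cid (edges_in_ends e))).1.
Definition edge_tgt (e : E) : V := (sval (cid (edges_in_ends e))).2.

Lemma edge_srctgt (e : E) :
  (val (val e) : {fset vertex d}) = [fset val (edge_src e);
    val (edge_tgt e)]%fset.
Proof. exact: (svalP (cid (edges_in_ends e))). Qed.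

Lemma fin_adjP G u v :
  reflect (adjacent G (val u) (val v)) (fin_adj edge_src edge_tgt (restr E G) u
    v).
Proof.
apply: (iffP existsP) => [[e /andP[Ge ends]]|[f [fuv Gf]]].
  exists (val e); split; last by move: Ge; rewrite ffunE.
  rewrite edge_srctgt.
  by case/orP: ends => /andP[/eqP-> /eqP->]//; rewrite fsetUC.
have fE : f \in E.
  apply/mem_edges_in; first exact: finite_fset.
  by move=> x; rewrite fuv !inE => /orP[]/eqP->; exact: valP.
exists [` fE]%fset; rewrite ffunE /= Gf /=.
have := edge_srctgt [` fE]%fset;
  rewrite /= fuv => /fset2_inj[[/val_inj-> /val_inj->]|[/val_inj-> /val_inj->]].
  by rewrite !eqxx.
by rewrite !eqxx orbT.
Qed.

Lemma fin_connect_cluster G u v :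
  connect (fin_adj edge_src edge_tgt (restr E G)) u v -> cluster G (val u) (val
    v).
Proof.
move=> /connectP[s]; elim/last_ind: s v => [|s z IHs] v /=.
  by move=> _ ->; exact: cluster_refl.
rewrite rcons_path last_rcons => /andP[ps /fin_adjP sz] ->.
exact: cluster_step (IHs _ ps erefl) sz.
Qed.

End finite_window.

Section window_box.
Context (d L : nat).
Local Notation V := (fset_set (box d L.+1)).
Local Notation E := (edges_in [set` V]).

Definition outer_layer : {set V} := [set v : V | ~~ `[< box d L (val v) >]]%SET.

(** Follow a walk to a point outside the window. Up to its first exit it uses edges of the window,
    and it exits from the outer layer because a step changes each coordinate by at most one. *)
Lemma infinite_wired (G : subgraph d) (u : V) : infinite_set (cluster G (val
  u)) ->
  wired (@edge_src d V) (@edge_tgt d V) outer_layer (restr E G) u.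
Proof.
move=> /infinite_clusterP; pose b := sval (cid (box_exists (val u))).
(* With [u] in the box of radius [b], a point farther than [b + L.+1] from [u] lies outside the
   window. *)
move=> /(_ (b + L.+1)%N)[y uy yout].
set c := connect (fin_adj (@edge_src d V) (@edge_tgt d V) (restr E G)).
have csym : connect_sym (fin_adj (@edge_src d V) (@edge_tgt d V) (restr E G)).
  exact: fin_conn_sym.
have : (exists2 v : V, v \in outer_layer & c u v) \/
       (exists2 v : V, val v = y & c u v).
  apply: (@cluster_ind d G (val u) (fun y => (exists2 v : V, v \in outer_layer
    & c u v) \/
       (exists2 v : V, val v = y & c u v))) uy.
    by right; exists u => //; exact: connect0.
  move=> a a' _ [h|[v <- uv] va']; first by left.
  have [a'b|a'b] := boolP (a' \in V).
    right; exists [` a'b]%fset => //; apply: (connect_trans uv).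
    by apply: connect1; exact/fin_adjP.
  left; exists v => //; rewrite inE; apply: contra a'b => /asboolP vL.
  rewrite mem_box; apply/asboolP.
  have va1 : box d 1 (a' - val v) by apply/boxN; rewrite opprB;
    exact: adjacent_box va'.
  by have := boxD va1 vL; rewrite add1n subrK.
case=> [[v vD uv]|[v vy _]].
  by apply/existsP; exists v; rewrite vD /= csym.
exfalso; apply: yout; rewrite /tbox /= addnC; apply: boxD.
  by rewrite -vy; apply/asboolP; rewrite -mem_box; exact: valP.
by apply/boxN; exact: (svalP (cid (box_exists (val u)))).
Qed.

Lemma card_outer_layer : (#|outer_layer| + L.*2.+1 ^ d = L.+1.*2.+1 ^ d)%N.
Proof.
rewrite -!card_box [in RHS]cardfE -(cardsC outer_layer); congr addn.
rewrite (_ : fset_set (box d L) = [fset val v | v in ~: outer_layer]%fset).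
  by rewrite card_imfset/=; [rewrite -cardE|exact: val_inj].
apply/fsetP => x; rewrite mem_box; apply/asboolP/imfsetP => /=.
  move=> xL; have xV : x \in V by rewrite mem_box; apply/asboolP/(box_le _ xL).
  by exists [` xV]%fset => //; rewrite !inE negbK; apply/asboolP.
by move=> [v]; rewrite !inE negbK => /asboolP vL ->.
Qed.

(** An edge is determined by its source and its displacement, one of the [3 ^ d] points of the unit
    box. *)
Lemma card_edges_in_box : (#|{: E}| <= L.+1.*2.+1 ^ d * 3 ^ d)%N.
Proof.
have unit_end (e : E) : val (edge_tgt e) - val (edge_src e) \in fset_set (box d
  1).
  rewrite mem_box; apply/asboolP/boxN; rewrite opprB.
  exact: edge_ends_box (edge_srctgt e).
pose h (e : E) : V * fset_set (box d 1) := (edge_src e, [` unit_end e]%fset).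
have h_inj : injective h.
  move=> e f [/= ef ef'].
  apply/val_inj/val_inj; rewrite /= !edge_srctgt ef; congr [fset _; _]%fset.
  by move: ef'; rewrite ef => /addIr.
have := leq_card h h_inj; rewrite card_prod -!cardfE !card_box.
by [].
Qed.

End window_box.

Section uniqueness.
Context (R : realType) (d : nat) (p : R) (mu : probability (subgraph d) R).
Hypotheses (p01 : 0 < p < 1) (muB : bernoulli_percolation p mu).
Implicit Types (x y z : vertex d) (e : edge d) (G : subgraph d).

Definition distinct_infinite x y : set (subgraph d) :=
  [set G | infinite_set (cluster G x)] `&`
  ([set G | infinite_set (cluster G y)] `&` ~` [set G | cluster G x y]).

Lemma measurable_distinct_infinite x y : measurable (distinct_infinite x y).
Proof.
apply: measurableI; first exact: measurable_infinite_cluster.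
apply: measurableI; first exact: measurable_infinite_cluster.
by apply: measurableC; exact: measurable_cluster.
Qed.

Lemma distinct_infinite_sym x y : distinct_infinite x y = distinct_infinite y x.
Proof.
by apply/seteqP; split => G [? [? nc]]; do !split => //; move=> /cluster_sym.
Qed.

Lemma distinct_infinite_translate x y z :
  mu (distinct_infinite (x + z) (y + z)) = mu (distinct_infinite x y).
Proof.
rewrite -(bernoulli_translate muB z (measurable_distinct_infinite x y)).
congr (mu _); apply/seteqP; split => G [/= i1 [/= i2 nc]]; split;
  [|split| |split] => /=.
- exact/infinite_cluster_translate.
- exact/infinite_cluster_translate.
- by move=> /cluster_translate.
- exact/infinite_cluster_translate.
- exact/infinite_cluster_translate.
- by move=> xy; apply: nc; apply/cluster_translate.
Qed.

(** All translates of [e] by the box of radius [N] are equally likely to join two infinite clusters,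
    they are distinct edges of the window, and such an edge has two arms there. The radius [M]
    leaves room for the ends of [e]. *)
Lemma distinct_infinite_count x y e M N delta : val e = [fset x; y]%fset ->
  box d M x -> box d M y -> 0 < delta -> delta <= p / 2 ->
  (N.*2.+1 ^ d)%:R * fine (mu (distinct_infinite x y)) <=
  (1 - p) * (#|outer_layer d (N + M)|%:R / delta +
     2 * tilt_cost p * delta *
     #|{: edges_in [set` fset_set (box d (N + M).+1)]}|%:R).
Proof.
move=> exy Mx My delta_gt0 delta_le.
set L := (N + M)%N.
pose V := fset_set (box d L.+1); pose E := edges_in [set` V].
have window z u : box d N z -> box d M u -> u + z \in V.
  move=> Nz Mu; rewrite mem_box; apply/asboolP.
  by apply: (@box_le _ (M + N)) (boxD Mu Nz); rewrite /L addnC.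
pose Z := fset_set (box d N).
have Zbox (z : Z) : box d N (val z) by apply/asboolP; rewrite -mem_box;
  exact: valP.
have zE (z : Z) : translate_edge (val z) e \in E.
  apply/mem_edges_in; first exact: finite_fset.
  move=> u; rewrite (_ : val _ = [fset (x + val z)%R; (y + val z)%R]%fset);
    last exact/translate_edgeE.
  by rewrite !inE => /orP[]/eqP->; apply: window.
pose h (z : Z) : E := [` zE z]%fset.
have h_inj : injective h.
  move=> z z' /(congr1 val)/= zz'; apply: val_inj.
  have : [fset (x + val z)%R; (y + val z)%R]%fset = [fset (x + val z')%R;
    (y + val z')%R]%fset.
    have /translate_edgeE <- := exy; rewrite zz'; exact/translate_edgeE.
  move=> /fset2_inj[[/addrI//]|[xy yx]].
  (* Two translates that coincide with their ends exchanged would give x - y = y - x, hence a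
     degenerate edge. *)
  have xy0 : x = y.
    apply/ffunP => i; have := congr1 (fun f : vertex d => f i) xy.
    have := congr1 (fun f : vertex d => f i) yx; rewrite !ffunE /= => h1 h2;
      lra.
  have [a [b [ab]]] := edge_ends e.
  have : a = b.
    have := ab; rewrite exy xy0 => /fset2_inj[[-> ->]|[-> ->]]//.
  by move=> ->; rewrite big1// => i _; rewrite subrr normr0.
have DI_sub (z : Z) : (mu (distinct_infinite x y) <=
    (\sum_(w | two_arms (@edge_src d V) (@edge_tgt d V) (outer_layer d L) w (h
      z)) weight p w)%:E)%E.
  rewrite -(bernoulli_restr muB) -(distinct_infinite_translate x y (val z)).
  rewrite le_measure ?inE//.
  - exact: measurable_distinct_infinite.
  - exact: (measurable_restr
      (fun w => two_arms (@edge_src d V) (@edge_tgt d V) (outer_layer d L) w (h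
        z))).
  have : (distinct_infinite (val (edge_src (h z))) (val (edge_tgt (h z)))) =
     distinct_infinite (x + val z) (y + val z).
    have := edge_srctgt (h z);
      rewrite (_ : val (val (h z)) = [fset (x + val z)%R; (y + val z)%R]%fset);
        last exact/translate_edgeE.
    by move=> /fset2_inj[[-> ->]|[-> ->]]//; exact: distinct_infinite_sym.
  move=> <- G [/= i1 [i2 nc]]; apply/and3P; split.
  - exact: infinite_wired.
  - exact: infinite_wired.
  - by apply/negP => /fin_connect_cluster.
have := sum_two_arms_le (@edge_src d V) (@edge_tgt d V) (outer_layer d L) p01
  delta_gt0 delta_le.
apply: le_trans.
rewrite -card_box mulr_natl cardfE -sumr_const.
rewrite (eq_bigr (fun w => \sum_e weight p w * (two_arms (@edge_src d V)
  (@edge_tgt d V)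
   (outer_layer d L) w e)%:R)); last by move=> w _; rewrite mulr_sumr.
rewrite exchange_big/=.
apply: (@le_trans _ _ (\sum_(z : Z) \sum_w weight p w * (two_arms (@edge_src d
  V) (@edge_tgt d V)
   (outer_layer d L) w (h z))%:R)).
  apply: ler_sum => z _; rewrite -lee_fin fineK ?fin_num_measure//;
    last exact: measurable_distinct_infinite.
  apply: le_trans (DI_sub z) _; rewrite lee_fin big_mkcond/=.
  by apply: ler_sum => w _; case: ifP => _; rewrite ?mulr1 ?mulr0.
rewrite -(big_imset (fun e : E => \sum_w weight p w * (two_arms (@edge_src d V)
  (@edge_tgt d V)
   (outer_layer d L) w e)%:R) (in2W h_inj))/=.
rewrite big_mkcond/=; apply: ler_sum => f _; case: ifP => // _.
by apply: sumr_ge0 => w _; rewrite mulr_ge0// weight_ge0.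
Qed.

Lemma bernoulli_ineq (u : R) n : 0 <= u <= 1 -> 1 - u *+ n <= (1 - u) ^+ n.
Proof.
move=> /andP[u0 u1]; elim: n => [|n IHn]; first by rewrite mulr0n subr0 expr0.
rewrite exprS mulrSr.
apply: (@le_trans _ _ ((1 - u) * (1 - u *+ n)));
  last by rewrite ler_wpM2l// subr_ge0.
have : 0 <= u * u *+ n by rewrite mulrn_wge0// mulr_ge0.
by rewrite mulrBl mul1r mulrBr mulr1 -mulrnAr; lra.
Qed.

(** If [m] were positive, [delta] could be fixed with [B * delta] at most m / 4, and [N] taken so
    large that the other term is at most m / 4 too. [B + 1] replaces [B] in the denominator in case
    [B] is zero. *)
Lemma le0_of_scaled_bound (m A B c : R) (M : nat) : 0 <= A -> 0 <= B -> 0 < c ->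
  (forall N delta, (M <= N)%N -> 0 < delta -> delta <= c ->
     m <= A / (N.+1%:R * delta) + B * delta) -> m <= 0.
Proof.
move=> A0 B0 c0 bound; rewrite leNgt; apply/negP => m0.
pose delta := Num.min c (m / (4 * (B + 1))).
have delta0 : 0 < delta by rewrite lt_min c0 divr_gt0// mulr_gt0//; lra.
have Bdelta : B * delta <= m / 4.
  apply: (@le_trans _ _ ((B + 1) * (m / (4 * (B + 1))))).
    by apply: ler_pM => //; [exact: ltW|lra|rewrite ge_min lexx orbT].
  by rewrite le_eqVlt; apply/orP; left; apply/eqP; field; lra.
pose N := maxn M (Num.truncn (4 * A / (m * delta))).
have := bound N delta (leq_maxl _ _) delta0.
rewrite ge_min lexx => /(_ isT).
have : A / (N.+1%:R * delta) <= m / 4.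
  rewrite ler_pdivrMr ?mulr_gt0//.
  have : 4 * A / (m * delta) < N.+1%:R.
    apply: lt_le_trans (truncnS_gt _) _; rewrite ler_nat ltnS; exact: leq_maxr.
  rewrite ltr_pdivrMr ?mulr_gt0// => h.
  by move: h; lra.
by move=> h1 h2; have := le_trans h2 (lerD h1 Bdelta); lra.
Qed.

Lemma distinct_infinite_adjacent x y e : val e = [fset x; y]%fset ->
  mu (distinct_infinite x y) = 0%E.
Proof.
move=> exy.
have mDI := measurable_distinct_infinite x y.
suff : fine (mu (distinct_infinite x y)) <= 0.
  move=> m0; apply/eqP; rewrite eq_le measure_ge0 andbT.
  by rewrite -[X in (X <= _)%E]fineK ?fin_num_measure// lee_fin.
have [p0 p1] : 0 < p /\ 0 < 1 - p by case/andP: p01; rewrite subr_gt0.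
have [Mx Mxb] := box_exists x; have [My Myb] := box_exists y.
pose M := maxn Mx My.
have Mbx : box d M x := box_le (leq_maxl _ _) Mxb.
have Mby : box d M y := box_le (leq_maxr _ _) Myb.
have kappa0 : 0 <= tilt_cost p.
  by rewrite /tilt_cost addr_ge0// divr_ge0// exprn_ge0// ltW.
apply: (@le0_of_scaled_bound _ ((1 - p) * 3 ^+ d * (2 *+ d))
   ((1 - p) * 3 ^+ d * (2 * tilt_cost p * 3 ^+ d)) (p / 2) M) => //.
- by rewrite !mulr_ge0 ?exprn_ge0 ?mulrn_wge0// ltW.
- by rewrite !mulr_ge0 ?exprn_ge0// ltW.
- by rewrite divr_gt0.
move=> N delta MN delta0 delta_le.
have := distinct_infinite_count N exy Mbx Mby delta0 delta_le.
set m := fine _; set L := (N + M)%N; set a : R := L.+1.*2.+1%:R.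
have a0 : 0 < a by rewrite ltr0n.
(* The outer layer is the fraction 1 - (1 - 2 / a)^d of the window, at most 2 d / a, and [a] is at
   least [N.+1]. *)
have layer : #|outer_layer d L|%:R <= a ^+ d * (2 *+ d / N.+1%:R).
  have /(congr1 (fun k => k%:R : R)) := card_outer_layer d L.
  rewrite natrD !natrX -/a => /(canRL (addrK _)) ->.
  have -> : L.*2.+1%:R = a * (1 - 2 / a) :> R.
    rewrite mulrBr mulr1 mulrCA divff ?gt_eqF// mulr1 /a.
    by rewrite doubleS -addn2 natrD addrK.
  rewrite exprMn -[X in X - _]mulr1 -mulrBr ler_pM2l ?exprn_gt0//.
  have u01 : 0 <= 2 / a <= 1.
    by rewrite divr_ge0 ?(ltW a0)//= ler_pdivrMr// mul1r ler_nat.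
  apply: (@le_trans _ _ ((2 / a) *+ d)).
    by rewrite lerBlDl -lerBlDr; exact: bernoulli_ineq.
  rewrite -mulrnAl ler_wpM2l ?mulrn_wge0// lef_pV2 ?posrE ?ltr0n// ler_nat /L.
  lia.
have edges : #|{: edges_in [set` fset_set (box d L.+1)]}|%:R <= a ^+ d * 3 ^+ d
  :> R.
  by rewrite -!natrX -natrM ler_nat card_edges_in_box.
(* Since M <= N, 2 (N + M) + 3 <= 3 (2 N + 1): the window exceeds the box of translations by a
   bounded factor only. *)
have a_le : a ^+ d <= 3 ^+ d * (N.*2.+1 ^ d)%:R.
  rewrite natrX -exprMn lerXn2r ?nnegrE ?(ltW a0) ?mulr_ge0//.
  by rewrite /a -natrM ler_nat /L; lia.
set b : R := (N.*2.+1 ^ d)%:R in a_le *;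
  have b0 : 0 < b by rewrite ltr0n expn_gt0.
have layer' : #|outer_layer d L|%:R <= 3 ^+ d * b * (2 *+ d / N.+1%:R).
  by apply: (le_trans layer); rewrite ler_wpM2r// divr_ge0// mulrn_wge0.
have edges' : #|{: edges_in [set` fset_set (box d L.+1)]}|%:R <= 3 ^+ d * b * 3
  ^+ d.
  by apply: (le_trans edges); rewrite ler_wpM2r// exprn_ge0.
move=> bm; rewrite -(ler_pM2l b0); apply: (le_trans bm).
apply: (@le_trans _ _ ((1 - p) * (3 ^+ d * b * (2 *+ d / N.+1%:R) / delta +
  2 * tilt_cost p * delta * (3 ^+ d * b * 3 ^+ d)))).
  rewrite ler_pM2l// lerD// ?ler_pM2r ?invr_gt0//.
  by rewrite ler_wpM2l// !mulr_ge0// ltW.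
rewrite le_eqVlt; apply/orP; left; apply/eqP; rewrite invfM; ring.
Qed.

(* If opening [e] does not connect [y] to the cluster of [x], then [y] inherits
   the infinite cluster of [y']; otherwise [y] already belongs to the cluster of
   [x]. *)
Lemma distinct_infinite_step x y y' e : val e = [fset y; y']%fset ->
  distinct_infinite x y' `<=`
  distinct_infinite y y' `|` insert e @^-1` distinct_infinite x y.
Proof.
move=> eyy' G [/= ix [/= iy' nxy']].
have adj_ins u v : adjacent G u v -> adjacent (insert e G) u v.
  by move=> [f [fuv Gf]]; exists f; rewrite /insert Gf orbT.
have cl_ins u v : cluster G u v -> cluster (insert e G) u v.
  apply: (@cluster_ind _ _ _ (cluster (insert e G) u));
    first exact: cluster_refl.
  by move=> a b _ ua /adj_ins; exact: cluster_step.
have yy' : cluster (insert e G) y y'.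
  by apply: cluster_step (cluster_refl _ _) _; exists e; rewrite /insert eqxx.
have [xy|xy] := pselect (cluster (insert e G) x y).
  have : cluster G x y \/ (cluster G x y \/ cluster G x y').
    apply: (@cluster_ind _ (insert e G) x
      (fun u => cluster G x u \/ (cluster G x y \/ cluster G x y'))) xy.
      by left; exact: cluster_refl.
    move=> u v _ [xu|h]; last by right.
    move=> [f [fuv]]; rewrite /insert => /orP[/eqP fe|Gf].
      right; have : [fset y; y']%fset = [fset u;
        v]%fset by rewrite -eyy' -fuv fe.
      by move=> /fset2_inj[[-> _]|[_ ->]]; [left|right].
    by left; apply: cluster_step xu _; exists f.
  move=> [|[|//]] {}xy; left; (split; [|split]) => //=.
  - by rewrite -(cluster_eq xy).
  - by move=> cyy'; apply: nxy'; exact: cluster_trans xy cyy'.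
  - by rewrite -(cluster_eq xy).
  - by move=> cyy'; apply: nxy'; exact: cluster_trans xy cyy'.
right; split; last split => //=.
- by apply: sub_infinite_set ix => u; exact: cl_ins.
- rewrite (cluster_eq yy').
  by apply: sub_infinite_set iy' => u; exact: cl_ins.
Qed.

(** Induction on the l1 distance: [u] is the neighbour of [y] one step closer to [x]. Two infinite
    clusters at [x] and [y] force either two at the adjacent pair [u], [y], or two at [x], [u] once
    the edge is opened; both events are null. *)
Lemma distinct_infinite_null x y : mu (distinct_infinite x y) = 0%E.
Proof.
have mDI := measurable_distinct_infinite.
pose l1 (v : vertex d) := (\sum_(i < d) absz (v i))%N.
have [n] : exists n, (l1 (y - x)%R <= n)%N by exists (l1 (y - x)%R).
elim: n y => [|n IHn] y.
  rewrite leqn0 /l1 sum_nat_eq0 => /forallP y0.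
  rewrite (_ : y = x).
    rewrite (_ : distinct_infinite x x = set0) ?measure0//.
    by apply/seteqP; split => G // [_ [_ /=]]; apply; exact: cluster_refl.
  apply/ffunP => i; have := y0 i; rewrite !ffunE /=; lia.
move=> yn; have [y0|] := pselect (l1 (y - x)%R <= n)%N; first exact: IHn.
move=> /negP; rewrite -ltnNge => yn'.
have [i yi] : exists i, (y - x : vertex d) i != 0.
  apply: contrapT => h; move: yn'; rewrite /l1 big1// => i _.
  have [->//|yi] := eqVneq ((y - x : vertex d) i) 0.
  by case: h; exists i.
pose s : int := if 0 < (y - x : vertex d) i then 1 else -1.
pose u : vertex d := y - [ffun j => if j == i then s else 0].
have uy : lattice_edges d [fset u; y]%fset.
  exists u, y; split=> //; rewrite (bigD1 i)//= big1 => [|j ji].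
    by rewrite !ffunE eqxx addr0 addrAC subrr add0r normrN /s; case: ifP => _;
      rewrite ?normrN normr1.
  by rewrite !ffunE (negbTE ji) subr0 subrr normr0.
pose e : edge d := SigSub (mem_set uy).
have eE : val e = [fset u; y]%fset by [].
have xu : mu (distinct_infinite x u) = 0%E.
  apply: IHn; rewrite -ltnS; apply: leq_trans yn; rewrite /l1; set w := y - x.
  rewrite (bigD1 i)//= [X in (_ < X)%N](bigD1 i)//= (eq_bigr (fun j => absz (w
    j))).
    by rewrite ltn_add2r !ffunE eqxx /s; move: yi; rewrite !ffunE; case: ifP;
      lia.
  by move=> j ji; rewrite !ffunE (negbTE ji); congr absz; lia.
apply/eqP; rewrite -measure_le0.
apply: (@le_trans _ _ (mu (distinct_infinite u y `|` insert e @^-1`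
  distinct_infinite x u))).
  apply: le_measure; rewrite ?inE//; last exact: distinct_infinite_step.
  apply: measurableU => //; rewrite -[X in measurable X]setTI.
  exact: measurable_insert.
have mIns : measurable (insert e @^-1` distinct_infinite x u).
  by rewrite -[X in measurable X]setTI; exact: measurable_insert.
apply: (le_trans (measureU2 mu (mDI u y) mIns)).
rewrite [X in (X + _)%E](distinct_infinite_adjacent eE).
by rewrite [X in (_ + X)%E](insertion_tolerance p01 muB e (mDI _ _) xu) adde0.
Qed.

End uniqueness.

(** * The covering and maximal inequalities *)

Lemma leq_expn2r (m n e : nat) : (m <= n)%N -> (m ^ e <= n ^ e)%N.
Proof. by case: e => // e mn; rewrite leq_exp2r. Qed.

Section vitali.
Context (R : realType) (d : nat).
Implicit Types (x y z : vertex d) (n : nat) (g : vertex d -> R).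

Definition tbox_fset z n : {fset vertex d} :=
  [fset (z + y)%R | y in fset_set (box d n)]%fset.

Lemma mem_tbox_fset z n x : (x \in tbox_fset z n) = `[< box d n (x - z) >].
Proof.
apply/imfsetP/asboolP => /=.
  by move=> [y]; rewrite mem_box => /asboolP yn ->; rewrite addrC addKr.
move=> xz; exists (x - z); last by rewrite addrC subrK.
by rewrite mem_box; exact/asboolP.
Qed.

Lemma sum_tbox z n g :
  \sum_(x <- tbox_fset z n) g x = \sum_(y <- fset_set (box d n)) g (z + y).
Proof. by rewrite big_imfset//= => x y _ _; exact: addrI. Qed.

Lemma card_tbox z n : #|` tbox_fset z n| = (n.*2.+1 ^ d)%N.
Proof. by rewrite card_imfset/= ?card_box//; exact: addrI. Qed.

Lemma sum_fsetD (A B : {fset vertex d}) g : (A `<=` B)%fset ->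
  \sum_(x <- B) g x = \sum_(x <- A) g x + \sum_(x <- (B `\` A)%fset) g x.
Proof.
move=> AB; rewrite -big_fset_disjointU/=; last first.
  by apply/fdisjointP => x xA; rewrite inE xA.
congr (\big[_/_]_(x <- enum_fset _) _); apply/fsetP => x; rewrite !inE.
by have := fsubsetP AB x; case: (x \in A) => //= ->.
Qed.

(** Greedy choice: take [z] with the largest radius. If the box of another point of [S] meets the
    box of [z], that point lies in the box of doubled radius around [z], which holds at most [2 ^ d]
    times as many points. The remaining boxes fit in [W] minus the box of [z], and induction
    applies. *)
Lemma vitali_boxes (lambda : R) g (r : vertex d -> nat) (S W : {fset vertex d})
  :
  0 < lambda -> (forall x, 0 <= g x) ->
  (forall z, z \in S -> (tbox_fset z (r z) `<=` W)%fset /\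
     lambda * ((r z).*2.+1 ^ d)%:R <= \sum_(y <- fset_set (box d (r z))) g (z +
       y)) ->
  lambda * #|` S|%:R <= 2 ^+ d * \sum_(x <- W) g x.
Proof.
move=> l0 g0; have [n] := ubnP #|` S|; elim: n S W => // n IHn S W Sn SW.
have [->|[z0 z0S]] := fset_0Vmem S.
  by rewrite cardfs0 mulr0 mulr_ge0// ?exprn_ge0// sumr_ge0.
pose z : vertex d := val [arg max_(i > [` z0S]%fset) r (val i)].
have zS : z \in S by exact: valP.
have zmax u : u \in S -> (r u <= r z)%N.
  move=> uS; rewrite /z; case: arg_maxnP => //= i _ /(_ [` uS]%fset); exact.
have [zW zlarge] := SW _ zS.
pose S1 := (S `&` tbox_fset z (r z).*2)%fset.
pose S2 := (S `\` S1)%fset.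
pose W2 := (W `\` tbox_fset z (r z))%fset.
have zS1 : z \in S1.
  rewrite inE zS mem_tbox_fset; apply/asboolP; rewrite subrr; exact: box0.
have S2_lt : (#|` S2| < n)%N.
  rewrite -ltnS; apply: leq_trans Sn; rewrite ltnS.
  apply: fproper_ltn_card; rewrite fproperE fsubsetDl /=.
  by apply/fsubsetPn; exists z; rewrite // inE zS1.
have IH : lambda * #|` S2|%:R <= 2 ^+ d * \sum_(x <- W2) g x.
  apply: IHn => // u; rewrite inE => /andP[uS1 uS].
  have [uW ularge] := SW _ uS; split => //.
  apply/fsubsetP => v vu; rewrite inE (fsubsetP uW)// andbT.
  apply: contra uS1; rewrite inE uS mem_tbox_fset => /asboolP vz.
  move: vu; rewrite !mem_tbox_fset => /asboolP vu; apply/asboolP.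
  have vu' : box d (r u) (u - v) by apply/boxN; rewrite opprB.
  have := boxD vu' vz; rewrite addrA subrK; apply: box_le.
  by rewrite -addnn leq_add2r zmax.
have S1_le : lambda * #|` S1|%:R <= 2 ^+ d * \sum_(x <- tbox_fset z (r z)) g x.
  rewrite sum_tbox;
    apply: (@le_trans _ _ (2 ^+ d * (lambda * ((r z).*2.+1 ^ d)%:R))).
    rewrite mulrCA ler_pM2l// -natrX -natrM ler_nat -expnMn.
    apply: (@leq_trans ((r z).*2.*2.+1 ^ d)%N).
      by rewrite -(card_tbox z); apply: fsubset_leq_card; exact: fsubsetIr.
    by apply: leq_expn2r; lia.
  by rewrite ler_pM2l ?exprn_gt0.
have S_split : #|` S|%:R = #|` S1|%:R + #|` S2|%:R :> R.
  rewrite -natrD; congr (_%:R); rewrite -(cardfsID S1 S); congr addn.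
  by rewrite (fsetIidPr _)//; exact: fsubsetIl.
rewrite S_split mulrDr (sum_fsetD _ zW) mulrDr.
exact: lerD.
Qed.

End vitali.

Lemma negligible_small (disp : measure_display) (T : measurableType disp)
    (R : realType) (P : {measure set T -> \bar R}) (N : set T) :
  (forall eps : R, 0 < eps -> exists M, [/\ measurable M, N `<=` M & (P M <=
    eps%:E)%E]) ->
  P.-negligible N.
Proof.
move=> small.
have /choice[M MP] n : exists M, [/\ measurable M, N `<=` M & (P M <=
  (n.+1%:R^-1)%:E)%E].
  by apply: small; rewrite invr_gt0.
exists (\bigcap_n M n); split.
- by apply: bigcapT_measurable => n; have [] := MP n.
- have le n : (P (\bigcap_n M n) <= (n.+1%:R^-1)%:E)%E.
    have [mM _] := MP n; apply: le_trans; apply: le_measure; rewrite ?inE//.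
      by apply: bigcapT_measurable => k; have [] := MP k.
    exact: bigcap_inf.
  apply/eqP; rewrite -measure_le0; apply/lee_addgt0Pr => e e0; rewrite add0e.
  apply: (le_trans (le (Num.truncn e^-1))); rewrite lee_fin.
  rewrite -[leRHS]invrK lef_pV2 ?posrE ?invr_gt0//.
  exact/ltW/truncnS_gt.
- by move=> x Nx n _; have [_ NM _] := MP n; exact: NM.
Qed.

Lemma card_box_ratio_cvg (R : realType) (d k : nat) :
  (((n + k).*2.+1 ^ d)%:R / (n.*2.+1 ^ d)%:R : R) @[n --> \oo] --> (1 : R).
Proof.
rewrite (_ : (fun n => _) =
    (fun n => (1 + k.*2%:R * (n.*2.+1%:R)^-1 : R) ^+ d)); last first.
  apply/funext => n; rewrite !natrX -expr_div_n; congr (_ ^+ d).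
  rewrite doubleD -addSn addnC natrD mulrDl divff ?pnatr_eq0// addrC.
  by [].
have inv_cvg : (n.*2.+1%:R^-1 : R) @[n --> \oo] --> (0 : R).
  apply: (@squeeze_cvgr _ _ _ _ (fun=> 0) (@harmonic R)).
  - apply: nearW => n; rewrite invr_ge0 ler0n /= lef_pV2 ?posrE// ler_nat.
    by lia.
  - exact: cvg_cst.
  - exact: cvg_harmonic.
have h1 : (1 + k.*2%:R * n.*2.+1%:R^-1 : R) @[n --> \oo] --> (1 + k.*2%:R * 0 :
  R).
  by apply: cvgD; [exact: cvg_cst|exact: cvgMr].
rewrite mulr0 addr0 in h1.
have := cvg_comp _ (fun x : R => x ^+ d) h1 (@exprn_continuous R d 1).
by rewrite expr1n.
Qed.

(** Both boxes lie in the box of radius [n + k], and each misses the same number of its points. *)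
Lemma sum_box_tbox_le (R : realType) (d n k : nat) (M : R) (g : vertex d -> R)
  (y : vertex d) :
  (forall x, `|g x| <= M) -> box d k y ->
  `|\sum_(x <- fset_set (box d n)) g x - \sum_(x <- fset_set (box d n)) g (y +
    x)| <=
  2 * M * (((n + k).*2.+1 ^ d)%:R - (n.*2.+1 ^ d)%:R).
Proof.
move=> gM yk; set W := fset_set (box d (n + k)).
have missing (A : {fset vertex d}) : (A `<=` W)%fset -> #|` A| = (n.*2.+1 ^
  d)%N ->
    `|\sum_(x <- W) g x - \sum_(x <- A) g x| <=
    M * (((n + k).*2.+1 ^ d)%:R - (n.*2.+1 ^ d)%:R).
  move=> AW cardA; rewrite (sum_fsetD _ AW) addrAC subrr add0r.
  apply: (le_trans (ler_norm_sum _ _ _)).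
  apply: (@le_trans _ _ (\sum_(x <- (W `\` A)%fset) M)); first exact: ler_sum.
  rewrite big_const_seq count_predT iter_addr_0 -[M *+ _]mulr_natr.
  rewrite -[size _]/(#|` (W `\` A)%fset|) cardfsD (fsetIidPr AW) cardA.
  by rewrite natrB -?cardA ?fsubset_leq_card// card_box.
rewrite -(sum_tbox y n g).
have b1 : (fset_set (box d n) `<=` W)%fset.
  apply/fsubsetP => x; rewrite !mem_box => /asboolP xn; apply/asboolP.
  by apply: box_le xn; exact: leq_addr.
have b2 : (tbox_fset y n `<=` W)%fset.
  apply/fsubsetP => x; rewrite mem_tbox_fset mem_box => /asboolP xy;
    apply/asboolP.
  by have := boxD xy yk; rewrite subrK.
have := missing _ b1 (card_box d n); have := missing _ b2 (card_tbox y n).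
set S := \sum_(x <- W) _; set A := \sum_(x <- fset_set _) _;
  set B := \sum_(x <- tbox_fset _ _) _.
move=> hB hA; rewrite (_ : A - B = (S - B) - (S - A)); last by ring.
apply: (le_trans (ler_normB _ _)).
by apply: (le_trans (lerD hB hA)); rewrite le_eqVlt; apply/orP; left;
  apply/eqP; ring.
Qed.

(** * Maximal inequality and averages of a measure-preserving action *)

Section ergodic.
Context (disp : measure_display) (Omega : measurableType disp) (R : realType)
  (P : probability Omega R) (d : nat) (tau : vertex d -> Omega -> Omega).
Hypotheses (mtau : forall z, measurable_fun setT (tau z))
  (Ptau : forall z A, measurable A -> P (tau z @^-1` A) = P A)
  (tauD : forall x z w, tau x (tau z w) = tau (x + z) w).
Implicit Types (f g h : Omega -> R) (c : R).

Lemma integral_tau f z : measurable_fun setT f -> (forall w, 0 <= f w) ->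
  (\int[P]_w (f (tau z w))%:E = \int[P]_w (f w)%:E)%E.
Proof.
move=> mf f0.
rewrite -[LHS](ge0_integral_pushforward (mtau z) P measurableT (f := EFin \o
  f)).
- apply: (@eq_measure_integral _ _ _ _ P (image_measure P (mtau z))) => A mA _.
  exact: Ptau.
- exact/measurable_EFinP.
- by move=> w _; rewrite /= lee_fin.
Qed.

Definition average n f w : R :=
  (#|` fset_set (box d n)|%:R)^-1 * \sum_(x <- fset_set (box d n)) f (tau x w).

Lemma card_box_gt0 n : 0 < #|` fset_set (box d n)|%:R :> R.
Proof. by rewrite card_box ltr0n expn_gt0. Qed.

Lemma measurable_tau f z : measurable_fun setT f ->
  measurable_fun setT (fun w => f (tau z w)).
Proof. by move=> mf; apply: measurableT_comp mf (mtau z). Qed.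

Lemma measurable_sum_tau f (s : seq (vertex d)) : measurable_fun setT f ->
  measurable_fun setT (fun w => \sum_(x <- s) f (tau x w)).
Proof. by move=> mf; apply: measurable_sum => x; exact: measurable_tau. Qed.

Lemma measurable_average n f : measurable_fun setT f ->
  measurable_fun setT (average n f).
Proof.
move=> mf; apply: measurable_funM; first exact: measurable_cst.
exact: measurable_sum_tau.
Qed.

Lemma integral_sum_tau f (s : seq (vertex d)) : measurable_fun setT f ->
  (forall w, 0 <= f w) ->
  (\int[P]_w (\sum_(x <- s) f (tau x w))%:E = (size s)%:R%:E * \int[P]_w (f
    w)%:E)%E.
Proof.
move=> mf f0.
under eq_integral do rewrite -sumEFin.
rewrite ge0_integral_sum//; last 2 first.
- by move=> x; apply/measurable_EFinP; exact: measurable_tau.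
- by move=> x w _; rewrite lee_fin.
under eq_bigr do rewrite integral_tau//.
elim: s => [|a s IHs]; first by rewrite big_nil mul0e.
by rewrite big_cons IHs /= -nat1r EFinD ge0_muleDl ?lee_fin// mul1e.
Qed.

Definition exceeds f (lambda : R) : set Omega :=
  [set w | exists n, lambda <= average n f w].

Definition exceeds_upto f (lambda : R) N : set Omega :=
  \bigcup_(n in [set n | (n <= N)%N]) [set w | lambda <= average n f w].

Lemma measurable_average_ge f lambda n : measurable_fun setT f ->
  measurable [set w | lambda <= average n f w].
Proof.
move=> mf; rewrite (_ : [set w | _] = average n f @^-1` `[lambda, +oo[%classic).
  by rewrite -[X in measurable X]setTI; apply: measurable_average.
by apply/seteqP; split => w; rewrite /= in_itv /= andbT.
Qed.

Lemma measurable_exceeds_upto f lambda N : measurable_fun setT f ->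
  measurable (exceeds_upto f lambda N).
Proof.
by move=> mf; apply: bigcup_measurable => n _; exact: measurable_average_ge.
Qed.

(** Transference: the covering lemma is applied along the orbit of [w], to the points of the box of
    radius [N] whose shift lies in the set. Radii are at most [N], so their boxes stay in the box of
    radius [2 N]. Integrating gives [4 ^ d]: one [2 ^ d] from the covering, one from the ratio of
    the two boxes. *)
Lemma maximal_upto f lambda N : measurable_fun setT f -> (forall w, 0 <= f w) ->
  0 < lambda ->
  (lambda%:E * P (exceeds_upto f lambda N) <= (4 ^+ d)%:E * \int[P]_w (f
    w)%:E)%E.
Proof.
move=> mf f0 l0.
set B := exceeds_upto f lambda N;
  have mB : measurable B by exact: measurable_exceeds_upto.
have pointwise w : lambda * \sum_(z <- fset_set (box d N)) \1_B (tau z w) <=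
    2 ^+ d * \sum_(x <- fset_set (box d N.*2)) f (tau x w).
  pose S := [fset z in fset_set (box d N) | tau z w \in B]%fset.
  have -> : \sum_(z <- fset_set (box d N)) \1_B (tau z w) = #|` S|%:R :> R.
    rewrite (eq_bigr (fun z => if tau z w \in B then 1 else 0)); last first.
      by move=> z _; rewrite indicE; case: (_ \in B).
    by rewrite -big_mkcond/= big_fset_condE/= big_const_seq count_predT
      iter_addr_0 cardfE.
  pose r z := xget 0%N [set n | (n <= N)%N /\ lambda <= average n f (tau z w)].
  apply: (vitali_boxes (r := r)) => // z.
  rewrite !inE mem_box => /andP[/asboolP zN /set_mem[n /= nN large]].
  have [rN rlarge] : (r z <= N)%N /\ lambda <= average (r z) f (tau z w).
    by apply: (xgetPex 0%N (P := [set n | (n <= N)%N /\ lambda <= average n f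
      (tau z w)])); exists n.
  split.
    apply/fsubsetP => v; rewrite mem_tbox_fset mem_box => /asboolP vz;
      apply/asboolP.
    have := boxD vz zN; rewrite subrK; apply: box_le.
    by rewrite -addnn leq_add2r.
  move: rlarge; rewrite /average mulrC ler_pdivlMr ?card_box_gt0// card_box.
  by under [in X in _ -> X]eq_bigr do rewrite addrC -tauD.
have : (\int[P]_w (lambda * \sum_(z <- fset_set (box d N)) \1_B (tau z w))%:E <=
    \int[P]_w (2 ^+ d * \sum_(x <- fset_set (box d N.*2)) f (tau x w))%:E)%E.
  apply: ge0_le_integral => //.
  - move=> w _; rewrite lee_fin mulr_ge0 ?(ltW l0)// sumr_ge0//.
  - apply/measurable_EFinP; apply: measurable_funM; first exact: measurable_cst.
    by apply: measurable_sum_tau; exact: measurable_indic.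
  - apply/measurable_EFinP; apply: measurable_funM; first exact: measurable_cst.
    exact: measurable_sum_tau.
  - by move=> w _; rewrite lee_fin.
have mI : measurable_fun setT (\1_B : Omega -> R) by exact: measurable_indic.
under eq_integral do rewrite EFinM.
rewrite ge0_integralZl//; last 3 first.
- by apply/measurable_EFinP; exact: measurable_sum_tau.
- by move=> w _; rewrite lee_fin sumr_ge0.
- by rewrite lee_fin ltW.
under [X in (_ <= X)%E]eq_integral do rewrite EFinM.
rewrite ge0_integralZl//; last 2 first.
- by apply/measurable_EFinP; exact: measurable_sum_tau.
- by move=> w _; rewrite lee_fin sumr_ge0.
rewrite !integral_sum_tau// integral_indic// setIT.
move=> bound.
rewrite -(@lee_pmul2l _ (#|` fset_set (box d N)|%:R)%:E)//; last first.
  by rewrite lte_fin card_box_gt0.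
rewrite muleCA; apply: (le_trans bound).
rewrite !muleA; apply: lee_wpmul2r; first by apply: integral_ge0 => w _;
  rewrite lee_fin.
rewrite -!EFinM lee_fin (_ : 4 = 2 * 2 :> R); last by ring.
rewrite exprMn [leRHS]mulrCA ler_pM2l ?exprn_gt0//.
rewrite !card_box -natrX -natrM ler_nat -expnMn.
by apply: leq_expn2r; lia.
Qed.

Lemma maximal f lambda : measurable_fun setT f -> (forall w, 0 <= f w) ->
  0 < lambda -> measurable (exceeds f lambda) /\
  (lambda%:E * P (exceeds f lambda) <= (4 ^+ d)%:E * \int[P]_w (f w)%:E)%E.
Proof.
move=> mf f0 l0.
have E : exceeds f lambda = \bigcup_N exceeds_upto f lambda N.
  apply/seteqP; split => w; first by move=> [n nw]; exists n => //;
    exists n => /=.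
  by move=> [N _ [n _ nw]]; exists n.
have mE : measurable (exceeds f lambda).
  by rewrite E; apply: bigcupT_measurable => N; exact: measurable_exceeds_upto.
split => //; rewrite -lee_pdivlMl//.
have cvgE : P \o exceeds_upto f lambda @ \oo --> P (exceeds f lambda).
  rewrite E; apply: nondecreasing_cvg_mu.
  - by move=> N; exact: measurable_exceeds_upto.
  - by rewrite -E.
  - move=> m n mn; apply/subsetPset => w [k /= km kw]; exists k => //=.
    exact: leq_trans mn.
apply: (cvge_le _ cvgE); apply: nearW => N /=.
by rewrite lee_pdivlMl//; exact: maximal_upto.
Qed.

Definition averages_to f c := {ae P, forall w, average n f w @[n --> \oo] -->
  c}.

Lemma averageD n f g w : average n (f \+ g) w = average n f w + average n g w.
Proof. by rewrite /average big_split/= mulrDr. Qed.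

Lemma averageZ n c f w : average n (fun w => c * f w) w = c * average n f w.
Proof. by rewrite /average -mulr_sumr mulrCA. Qed.

Lemma average_cst n c w : average n (cst c) w = c.
Proof.
rewrite /average /cst big_const_seq count_predT iter_addr_0 -[c *+ _]mulr_natl
  mulrA mulVf ?mul1r//.
by rewrite gt_eqF// card_box_gt0.
Qed.

Lemma ler_norm_average n f w : `|average n f w| <= average n (fun w => `|f w|)
  w.
Proof.
rewrite /average normrM ger0_norm ?invr_ge0//.
by rewrite ler_wpM2l ?invr_ge0//; exact: ler_norm_sum.
Qed.

Lemma averages_toD f g c c' : averages_to f c -> averages_to g c' ->
  averages_to (f \+ g) (c + c').
Proof.
move=> fc gc; apply: filterS2 fc gc => w fc gc.
under eq_fun do rewrite averageD.
exact: cvgD.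
Qed.

Lemma averages_toZ f a c : averages_to f c -> averages_to (fun w => a * f w) (a
  * c).
Proof.
move=> fc; apply: filterS fc => w fc.
under eq_fun do rewrite averageZ.
exact: cvgMr.
Qed.

Lemma averages_to_cst c : averages_to (cst c) c.
Proof.
apply: aeW => w; under eq_fun do rewrite average_cst.
exact: cvg_cst.
Qed.

Lemma averages_to_sum (I : Type) (s : seq I) (F : I -> Omega -> R) (C : I -> R)
  :
  (forall i, averages_to (F i) (C i)) ->
  averages_to (fun w => \sum_(i <- s) F i w) (\sum_(i <- s) C i).
Proof.
move=> FC; elim: s => [|i s IHs].
  rewrite big_nil (_ : (fun w => _) = cst 0); first exact: averages_to_cst.
  by apply/funext => w; rewrite big_nil.
rewrite big_cons (_ : (fun w => _) = F i \+ fun w => \sum_(j <- s) F j w).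
  exact: averages_toD.
by apply/funext => w; rewrite big_cons.
Qed.

(** The distance from [c] to the average of [f] splits into three parts: |c - c'|, the convergence
    for [h], and the average of |f - h|, which the maximal inequality keeps below lambda for all [n]
    outside a small set. *)
Lemma averages_to_approx f c : measurable_fun setT f ->
  (forall eps : R, 0 < eps -> exists h c', [/\ measurable_fun setT h,
    averages_to h c',
     `|c - c'| <= eps & (\int[P]_w (`|f w - h w|)%:E <= eps%:E)%E]) ->
  averages_to f c.
Proof.
move=> mf approx.
pose bad (lambda : R) := [set w | ~ \forall n \near \oo, `|c - average n f w|
  <= lambda].
have badN (lambda : R) : 0 < lambda -> P.-negligible (bad (3 * lambda)).
  move=> l0; apply: negligible_small => eps e0.
  have K0 : 0 < (4 ^+ d : R) by rewrite exprn_gt0.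
  (* At most lambda to control |c - c'|, and such that the maximal inequality bounds the exceptional
     probability by 4^d eta / lambda <= eps. *)
  pose eta := Num.min lambda (lambda * eps / 4 ^+ d).
  have eta0 : 0 < eta by rewrite lt_min l0 divr_gt0// mulr_gt0.
  have [h [c' [mh [Z [mZ Z0 hZ]] cc' fh]]] := approx eta eta0.
  have mfh : measurable_fun setT (fun w => `|f w - h w|).
    by apply: measurableT_comp => //; exact: measurable_funB.
  have [mE Ele] := maximal mfh (fun w => normr_ge0 _) l0.
  exists (exceeds (fun w => `|f w - h w|) lambda `|` Z); split.
  - exact: measurableU.
  - move=> w badw; apply: contrapT => /not_orP[notE notZ]; apply: badw.
    have hw : average n h w @[n --> \oo] --> c'.
      by apply: contrapT => nh; apply: notZ; apply: hZ.
    have : \forall n \near \oo, `|c' - average n h w| <= lambda.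
      by move/cvgrPdist_le : hw; apply.
    apply: filterS => n hn.
    have fhn : `|average n h w - average n f w| <= lambda.
      have -> : average n h w - average n f w = - average n (fun w => f w - h
        w) w.
        rewrite /average -mulrBr -mulrN -sumrB -sumrN; congr (_ * _).
        by apply: eq_bigr => x _; rewrite opprB.
      rewrite normrN; apply: (le_trans (ler_norm_average _ _ _)).
      by rewrite leNgt; apply/negP => /ltW large; apply: notE; exists n.
    have cc'l : `|c - c'| <= lambda by apply: (le_trans cc');
      rewrite ge_min lexx.
    rewrite (_ : c - average n f w = (c - c') + (c' - average n h w) +
      (average n h w - average n f w)); last by ring.
    apply: (le_trans (ler_normD _ _)).
    rewrite (_ : 3 * lambda = lambda + lambda + lambda); last by ring.
    apply: lerD => //; apply: (le_trans (ler_normD _ _)); exact: lerD.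
  - apply: (le_trans (measureU2 P mE mZ)); rewrite [X in (_ + X)%E]Z0 adde0.
    rewrite -(@lee_pmul2l _ lambda%:E)//.
    apply: (le_trans Ele); rewrite -EFinM.
    apply: (@le_trans _ _ ((4 ^+ d)%:E * eta%:E)%E).
      by apply: lee_wpmul2l; rewrite // lee_fin ltW.
    rewrite -EFinM lee_fin mulrC -ler_pdivlMr//.
    by rewrite ge_min lexx orbT.
suff : P.-negligible (\bigcup_k bad (3 * k.+1%:R^-1)).
  apply: negligibleS => w nc; apply: contrapT => h; apply: nc.
  apply/cvgrPdist_le => e e0.
  have [k ke] : exists k, 3 * k.+1%:R^-1 <= e.
    exists (Num.truncn (3 / e)); rewrite ler_pdivrMr// mulrC -ler_pdivrMr//.
    exact/ltW/truncnS_gt.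
  have : \forall n \near \oo, `|c - average n f w| <= 3 * k.+1%:R^-1.
    by apply: contrapT => nk; apply: h; exists k.
  by apply: filterS => n; move/le_trans; apply.
by apply: negligible_bigcup => k; apply: badN; rewrite invr_gt0.
Qed.

Lemma averages_to_coboundary f (M : R) y : (forall w, `|f w| <= M) ->
  averages_to (fun w => f w - f (tau y w)) 0.
Proof.
move=> fM; have [k yk] := box_exists y; apply: aeW => w.
apply/cvgrPdist_le => e e0.
have M0 : 0 <= M := le_trans (normr_ge0 _) (fM w).
(* [2 * M + 1] is used because [M] may be zero. *)
have e'0 : 0 < e / (2 * M + 1) by rewrite divr_gt0//; lra.
have /cvgrPdist_le/(_ _ e'0) := @card_box_ratio_cvg R d k.
apply: filterS => n; rewrite distrC => hn.
rewrite sub0r normrN /average normrM normfV normr_nat card_box.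
have b0 : 0 < (n.*2.+1 ^ d)%:R :> R by rewrite ltr0n expn_gt0.
rewrite ler_pdivrMl// sumrB.
have := @sum_box_tbox_le R d n k M (fun x => f (tau x w)) y (fun x => fM _) yk.
have -> : \sum_(x <- fset_set (box d n)) f (tau (y + x) w) =
   \sum_(x <- fset_set (box d n)) f (tau y (tau x w)).
  by apply: eq_bigr => x _; rewrite tauD.
move/le_trans; apply.
set c := (n.*2.+1 ^ d)%:R in b0 hn *; set c' := ((n + k).*2.+1 ^ d)%:R in hn *.
have c'c : c' - c <= c * (e / (2 * M + 1)).
  have -> : c' - c = c * (c' / c - 1) by field; rewrite gt_eqF.
  rewrite ler_pM2l//; exact: le_trans (ler_norm _) hn.
apply: (@le_trans _ _ (2 * M * (c * (e / (2 * M + 1)))));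
  first by rewrite ler_wpM2l// mulr_ge0.
rewrite mulrCA ler_pM2l// mulrA ler_pdivrMr; last by lra.
by rewrite [2 * M * e]mulrC ler_pM2l//; lra.
Qed.

Lemma averages_to_sub_average f (M : R) N : (forall w, `|f w| <= M) ->
  averages_to (fun w => f w - average N f w) 0.
Proof.
move=> fM.
have := averages_toZ (#|` fset_set (box d N)|%:R)^-1 (@averages_to_sum _
  (fset_set (box d N))
  (fun y w => f w - f (tau y w)) (fun=> 0) (fun y => averages_to_coboundary y
    fM)).
rewrite big1// mulr0; congr averages_to; apply/funext => w.
rewrite sumrB mulrBr big_const_seq count_predT iter_addr_0 -[f w *+ _]mulr_natl
  mulrA mulVf ?mul1r//.
by rewrite gt_eqF// card_box_gt0.
Qed.

Lemma integral_average f N : measurable_fun setT f -> (forall w, 0 <= f w) ->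
  (\int[P]_w (average N f w)%:E = \int[P]_w (f w)%:E)%E.
Proof.
move=> mf f0; under eq_integral do rewrite EFinM.
rewrite ge0_integralZl//; last 2 first.
- by apply/measurable_EFinP; exact: measurable_sum_tau.
- by move=> w _; rewrite lee_fin sumr_ge0.
rewrite integral_sum_tau// muleA -EFinM mulVf ?mul1e//.
by rewrite gt_eqF// card_box_gt0.
Qed.

(* [\1_E] is the sum of [\1_E - A_N \1_E], whose averages tend to [0] everywhere,
   of [q], and of [A_N \1_E - q], which is small in mean square. *)
Lemma averages_to_indic (E : set Omega) (q : R) L : (0 < d)%N -> measurable E
  -> P E = q%:E ->
  (forall x, ~ box d L x -> P (E `&` tau x @^-1` E) = (q ^+ 2)%:E) ->
  averages_to \1_E q.
Proof.
move=> d0 mE PE far.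
have mI : measurable_fun setT (\1_E : Omega -> R) by exact: measurable_indic.
have q0 : 0 <= q by rewrite -lee_fin -PE measure_ge0.
have I1 w : `|\1_E w : R| <= 1 by rewrite indicE; case: (_ \in E);
  rewrite ?normr1 ?normr0.
have pair x y : P (tau x @^-1` E `&` tau y @^-1` E) = P (E `&` tau (y - x)
  @^-1` E).
  rewrite -[RHS](Ptau x); last first.
    by apply: measurableI => //; rewrite -[X in measurable X]setTI; exact: mtau.
  by congr (P _); apply/seteqP; split => w /=; rewrite tauD subrK.
have meas_pair x y : measurable (tau x @^-1` E `&` tau y @^-1` E).
  by apply: measurableI; rewrite -[X in measurable X]setTI; exact: mtau.
(* Pairs at distance at most [L] are bounded by one; each [x] has at most as many such [y] as the
   box of radius [L] has points, which yields the error [b L / b N]. *)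
have far_le x y : (P (tau x @^-1` E `&` tau y @^-1` E) <=
    (q ^+ 2 + (y \in tbox_fset x L)%:R)%:E)%E.
  rewrite pair mem_tbox_fset; case: asboolP => [_|/far->];
    last by rewrite addr0.
  have mEy : measurable (E `&` tau (y - x) @^-1` E).
    by apply: measurableI => //; rewrite -[X in measurable X]setTI; exact: mtau.
  apply: (le_trans (probability_le1 P mEy)).
  by rewrite lee_fin lerDr exprn_ge0.
pose b N : R := #|` fset_set (box d N)|%:R.
have b0 N : 0 < b N by exact: card_box_gt0.
have square N : (\int[P]_w (average N \1_E w ^+ 2)%:E <= (q ^+ 2 + b L / b
  N)%:E)%E.
  have E2 w : average N \1_E w ^+ 2 = (b N) ^- 2 *
      \sum_(x <- fset_set (box d N)) \sum_(y <- fset_set (box d N))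
        \1_(tau x @^-1` E `&` tau y @^-1` E) w.
    rewrite /average exprMn exprVn; congr (_ * _).
    rewrite expr2 mulr_suml; apply: eq_bigr => x _.
    rewrite mulr_sumr; apply: eq_bigr => y _.
    by rewrite indicI /= !indicE.
  under eq_integral do rewrite E2 EFinM.
  have mS x : measurable_fun setT (fun w => \sum_(y <- fset_set (box d N))
        \1_(tau x @^-1` E `&` tau y @^-1` E) w : R).
    by apply: measurable_sum => y; exact: measurable_indic.
  rewrite ge0_integralZl//; last 3 first.
  - by apply/measurable_EFinP; exact: measurable_sum.
  - by move=> w _; rewrite lee_fin; do 2 (apply: sumr_ge0 => ? _).
  - by rewrite lee_fin invr_ge0 exprn_ge0// ltW.
  under eq_integral do rewrite -sumEFin.
  rewrite ge0_integral_sum//; last 2 first.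
  - by move=> x; apply/measurable_EFinP.
  - by move=> x w _; rewrite lee_fin sumr_ge0.
  have -> : (q ^+ 2 + b L / b N)%:E = (((b N) ^- 2)%:E *
      \sum_(x <- fset_set (box d N)) (b N * q ^+ 2 + b L)%:E)%E.
    rewrite sumEFin -EFinM big_const_seq count_predT iter_addr_0 -[(_ + _) *+
      size _]mulr_natl.
    by congr EFin; rewrite -[X in _ * (X * _)]/(b N); field; rewrite gt_eqF //;
      exact: b0.
  apply: lee_wpmul2l; first by rewrite lee_fin invr_ge0 exprn_ge0 // ltW.
  apply: lee_sum => x _.
  under eq_integral do rewrite -sumEFin.
  rewrite ge0_integral_sum//; last by move=> y; apply/measurable_EFinP;
    exact: measurable_indic.
  under eq_bigr => y _ do rewrite integral_indic ?setIT//.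
  apply: (@le_trans _ _ (\sum_(y <- fset_set (box d N)) (q ^+ 2 + (y \in
    tbox_fset x L)%:R)%:E)%E).
    by apply: lee_sum => y _; exact: far_le.
  rewrite sumEFin lee_fin big_split/=; apply: lerD.
    by rewrite big_const_seq count_predT iter_addr_0 -[_ *+ size _]mulr_natl.
  rewrite -natr_sum ler_nat /= -big_mkcond/= big_fset_condE/= sum1_size.
  rewrite card_box -(card_tbox x L); apply: fsubset_leq_card.
  by apply/fsubsetP => y; rewrite !inE => /andP[].
have mA N : measurable_fun setT (average N \1_E) by exact: measurable_average.
(* The mean square is computed after adding [2 q A] to [(A - q)^2], so that
   only nonnegative functions are integrated. *)
have moment N : (\int[P]_w ((average N \1_E w - q) ^+ 2)%:E <= (b L / b
  N)%:E)%E.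
  have A0 w : 0 <= average N \1_E w.
    rewrite /average mulr_ge0 ?invr_ge0//; apply: sumr_ge0 => x _;
      by rewrite indicE ler0n.
  have : (\int[P]_w (((average N \1_E w - q) ^+ 2)%:E + ((2 * q) * average N
    \1_E w)%:E) =
      \int[P]_w ((average N \1_E w ^+ 2)%:E + (cst (q ^+ 2)%:E w)))%E.
    by apply: eq_integral => w _; rewrite -!EFinD; congr EFin; rewrite /=; ring.
  rewrite ge0_integralD//; last 4 first.
  - by move=> w _; rewrite lee_fin sqr_ge0.
  - by apply/measurable_EFinP/measurable_funX/measurable_funB.
  - by move=> w _; rewrite lee_fin; apply: mulr_ge0;
      [exact: mulr_ge0|exact: A0].
  - by apply/measurable_EFinP/measurable_funM.
  rewrite ge0_integralD//; last 3 first.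
  - by move=> w _; rewrite lee_fin sqr_ge0.
  - by apply/measurable_EFinP/measurable_funX.
  - by move=> w _; rewrite lee_fin sqr_ge0.
  under [X in (_ + X)%E = _ -> _]eq_integral do rewrite EFinM.
  rewrite ge0_integralZl//; last 3 first.
  - exact/measurable_EFinP.
  - by move=> w _; rewrite lee_fin.
  - by rewrite lee_fin mulr_ge0.
  have intE : (\int[P]_w (\1_E w)%:E = q%:E)%E by rewrite integral_indic//
    setIT -PE.
  rewrite integral_average// intE integral_cst//.
  rewrite [X in (_ = _ + _ * X)%E -> _](_ : _ = 1%E);
    last exact: probability_setT.
  rewrite mule1 -EFinM => eqI.
  rewrite -(@leeD2rE _ (2 * q * q)%:E)// eqI -EFinD.
  apply: (le_trans (leeD2r _ (square N))).
  by rewrite -EFinD lee_fin le_eqVlt; apply/orP; left; apply/eqP; ring.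
apply: averages_to_approx => // eps eps0.
have [N bN] : exists N, b L / b N <= eps ^+ 2.
  exists (Num.truncn (b L / eps ^+ 2)).
  have eps2 : 0 < eps ^+ 2 by rewrite exprn_gt0.
  rewrite ler_pdivrMr// mulrC -ler_pdivrMr//.
  apply: (le_trans (ltW (truncnS_gt _))); rewrite [b _ in leRHS]/b ler_nat.
  (* As [d] is positive, the box of radius [n] has at least 2 n + 1 points. *)
  set n := Num.truncn _; apply: (@leq_trans (n.*2.+1 ^ 1)%N);
    first by rewrite expn1; lia.
  by rewrite card_box; exact: leq_pexp2l.
have absE w : `|\1_E w - (\1_E w - average N \1_E w + q)| = `|average N \1_E w
  - q|.
  by congr `|_|; ring.
exists (fun w => \1_E w - average N \1_E w + q), q; split.
- by apply: measurable_funD => //; exact: measurable_funB.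
- have := averages_toD (averages_to_sub_average N I1) (averages_to_cst q).
  by rewrite add0r.
- by rewrite subrr normr0 ltW.
- under eq_integral do rewrite absE.
  have msq : measurable_fun setT (fun w => (average N \1_E w - q) ^+ 2).
    by apply: measurable_funX; exact: measurable_funB.
  (* From mean square to L^1 through |a| <= eps / 2 + a^2 / (2 eps); with a second moment of at most
     eps^2 the total is eps. *)
  apply: (@le_trans _ _ (\int[P]_w (cst (eps / 2)%:E w + ((2 * eps)^-1 *
     (average N \1_E w - q) ^+ 2)%:E))%E).
    apply: ge0_le_integral => //.
    + apply/measurable_EFinP; apply: measurableT_comp => //.
      exact: measurable_funB.
    + by apply: emeasurable_funD => //; apply/measurable_EFinP;
        exact: measurable_funM.
    + move=> w _; rewrite -EFinD lee_fin.
      set a := average _ _ _ - q.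
      have h : 0 <= (`|a| - eps) ^+ 2 by rewrite sqr_ge0.
      rewrite -(ler_pM2l (_ : 0 < 2 * eps)); last by rewrite mulr_gt0.
      rewrite -[a ^+ 2]real_normK ?num_real//.
      have -> : 2 * eps * (eps / 2 + (2 * eps)^-1 * `|a| ^+ 2) = eps ^+ 2 +
        `|a| ^+ 2.
        by field; rewrite gt_eqF.
      move: h; rewrite sqrrB; lra.
  have i2 : 0 <= (2 * eps)^-1 by rewrite invr_ge0 mulr_ge0// ltW.
  rewrite ge0_integralD//; last 3 first.
  + by move=> w _; rewrite lee_fin divr_ge0// ltW.
  + by move=> w _; rewrite lee_fin mulr_ge0// sqr_ge0.
  + by apply/measurable_EFinP; exact: measurable_funM.
  under [X in (_ + X)%E]eq_integral do rewrite EFinM.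
  rewrite ge0_integralZl//; last 2 first.
  + exact/measurable_EFinP.
  + by move=> w _; rewrite lee_fin sqr_ge0.
  rewrite integral_cst//.
  rewrite [X in (_ * X + _)%E](_ : _ = 1%E); last exact: probability_setT.
  rewrite mule1.
  apply: (@le_trans _ _ ((eps / 2)%:E + (2 * eps)^-1%:E * (eps ^+ 2)%:E)%E).
    apply: leeD2l; apply: lee_wpmul2l; first by rewrite lee_fin.
    by apply: (le_trans (moment N)); rewrite lee_fin.
  rewrite -EFinM -EFinD lee_fin le_eqVlt; apply/orP; left; apply/eqP.
  by field; rewrite gt_eqF.
Qed.

End ergodic.

(** * The color measure *)

Section color.
Context (R : realType) (d : nat).
Implicit Types (G : subgraph d) (f : coloring R d) (x y z : vertex d).

Lemma connected_cluster G x : connected_in G (cluster G x).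
Proof.
move=> u v xu xv.
have [s [ps ls]] : cluster G u v by apply: cluster_trans xv; exact: cluster_sym.
exists s => // w /= ws; move: ps ls.
case/splitPr: ws => s1 s2; rewrite cat_path /= => /and3P[p1 lw _] _.
apply: (cluster_trans xu); exists (rcons s1 w); split;
  last by rewrite last_rcons.
by rewrite rcons_path p1.
Qed.

Definition shift_color z f : coloring R d := fun x => f (x + z).

Lemma measurable_shift_color z : measurable_fun setT (shift_color z).
Proof. by apply: measurable_to_product => x; exact: measurable_coordinate. Qed.

Lemma measurable_color x (B : set R) : measurable B ->
  measurable [set f : coloring R d | B (f x)].
Proof.
move=> mB; rewrite (_ : [set f | _] = (fun f : coloring R d => f x) @^-1` B)//.
by rewrite -[X in measurable X]setTI; exact: measurable_coordinate.
Qed.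

Definition disagree (S : set (vertex d)) : set (coloring R d) :=
  [set f | exists x y, [/\ S x, S y & f x <> f y]].

Lemma measurable_disagree S : measurable (disagree S).
Proof.
rewrite (_ : disagree S = \bigcup_(x in S) \bigcup_(y in S) [set f : coloring R
  d | f x <> f y]).
  rewrite bigcup_mkcond; apply: countable_bigcupT_measurable;
    first exact: countableP.
  move=> x; case: ifP => // _; rewrite bigcup_mkcond.
  apply: countable_bigcupT_measurable; first exact: countableP.
  move=> y; case: ifP => // _.
  rewrite (_ : [set f | _] =
      (fun f : coloring R d => f x - f y) @^-1` (~` [set 0])); last first.
    by apply/seteqP; split => f /= fxy; [move=> /subr0_eq|move=> fe;
      apply: fxy; rewrite fe subrr].
  rewrite -[X in measurable X]setTI; apply: measurable_funB => //.
  - exact: measurable_coordinate.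
  - exact: measurable_coordinate.
  - by apply: measurableC; exact: measurable_set1.
apply/seteqP; split => f.
- by move=> [x [y [Sx Sy fxy]]]; exists x => //; exists y.
- by move=> [x Sx [y Sy fxy]]; exists x, y.
Qed.

Lemma color_disagree0 G nu (P : {measure set (coloring R d) -> \bar R}) S :
  color_measure G nu P -> connected_in G S -> P (disagree S) = 0%E.
Proof.
move=> [_ _ ae] /ae ae0; apply: measure_negligible;
  first exact: measurable_disagree.
apply: negligibleS ae0 => f [x [y [Sx Sy fxy]]] /= h; exact/fxy/h.
Qed.

Section determined.
Context (G : subgraph d) (F : {fset vertex d}).

(* The default value [0] does not depend on [x], so that [repr_site] is constant
   on clusters. *)
Definition repr_site x : vertex d :=
  xget 0 [set y | y \in F /\ cluster G x y].

Lemma repr_siteP x : x \in F -> repr_site x \in F /\ cluster G x (repr_site x).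
Proof.
move=> xF; apply: (xgetPex 0 (P := [set y | y \in F /\ cluster G x y])).
by exists x; split => //; exact: cluster_refl.
Qed.

Lemma repr_site_eq x y : cluster G x y -> repr_site x = repr_site y.
Proof. by move=> /cluster_eq xy; rewrite /repr_site xy. Qed.

(** Off a null set each site of [F] has the color of its representative, and representatives lie in
    distinct clusters, hence are independent. The right-hand side involves only [G] and [nu], which
    is why the color measure is unique. *)
Lemma color_cylinder (nu : probability R R) (P : {measure set (coloring R d) ->
  \bar R})
    (B : vertex d -> set R) : color_measure G nu P ->
  (forall x, measurable (B x)) -> (forall x, x \notin F -> B x = setT) ->
  P (cylinder B) = (\prod_(y <- [fset repr_site x | x in F]%fset)
     nu (\bigcap_(x in [set x | x \in F /\ repr_site x = y]) B x))%E.
Proof.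
move=> colP mB BF; have [margP indP _] := colP.
pose F' := [fset repr_site x | x in F]%fset.
pose B' y := \bigcap_(x in [set x | x \in F /\ repr_site x = y]) B x.
have mB' y : measurable (B' y).
  apply: fin_bigcap_measurable => // ;
    apply: (@sub_finite_set _ _ [set` F]) => //.
  by move=> x [].
have distF' : in_distinct_clusters G [set` F'].
  move=> _ _ /= /imfsetP[x /= xF ->] /imfsetP[y /= yF ->] ne cl; apply: ne.
  have [_ cx] := repr_siteP xF; have [_ cy] := repr_siteP yF.
  apply: repr_site_eq; apply: (cluster_trans cx); rewrite cl;
    exact: cluster_sym.
transitivity (P (\bigcap_(y in [set` F']) (fun f : coloring R d => f y) @^-1`
  B' y)); last first.
  rewrite (indP _ distF')//; apply: eq_bigr => y _; exact: margP.
pose N := \big[setU/set0]_(x <- F) disagree (cluster G x).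
have mN : measurable N by apply: bigsetU_measurable => x _;
  exact: measurable_disagree.
have N0 : P N = 0%E.
  apply: measure_negligible => //; rewrite /N; elim/big_ind : _ => //.
  - exact: negligible_set0.
  - by move=> ? ?; exact: negligibleU.
  - move=> x _; apply/negligibleP; first exact: measurable_disagree.
    exact: color_disagree0 colP (@connected_cluster G x).
have mC : measurable (cylinder B).
  rewrite (cylinderE BF); apply: fin_bigcap_measurable => // x _.
  exact: measurable_color.
have mC' : measurable (\bigcap_(y in [set` F']) (fun f : coloring R d => f y)
  @^-1` B' y).
  by apply: fin_bigcap_measurable => // y _; exact: measurable_color.
have le_null (C D : set (coloring R d)) : measurable C -> measurable D ->
    C `<=` D `|` N -> (P C <= P D)%E.
  move=> mC0 mD CD; apply: (@le_trans _ _ (P (D `|` N))).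
    by apply: le_measure; rewrite ?inE//; exact: measurableU.
  by apply: (le_trans (measureU2 P mD mN)); rewrite [X in (_ + X)%E]N0 adde0.
have agree f x : ~ N f -> x \in F -> f x = f (repr_site x).
  move=> nN xF; apply: contrapT => ne; apply: nN; rewrite /N -bigcup_fset.
  by exists x => //=; exists x, (repr_site x); split => //;
    [exact: cluster_refl|exact: (repr_siteP xF).2].
apply/eqP; rewrite eq_le; apply/andP; split; apply: le_null => // f Cf.
- have [Nf|nN] := pselect (N f); [by right|left].
  move=> y _ x [xF <-] /=; rewrite -agree//; exact: Cf.
- have [Nf|nN] := pselect (N f); [by right|left].
  move=> x; have [xF|/BF->//] := boolP (x \in F).
  rewrite (agree _ _ nN xF).
  by apply: (Cf (repr_site x)) => //=; apply/imfsetP; exists x.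
Qed.

End determined.

Lemma color_measure_unique G (nu : probability R R)
    (P1 P2 : {measure set (coloring R d) -> \bar R}) :
  color_measure G nu P1 -> color_measure G nu P2 ->
  forall A, measurable A -> P1 A = P2 A.
Proof.
move=> col1 col2; apply: product_measure_unique.
  have [/(_ 0 setT measurableT) P1T _ _] := col1.
  by rewrite (_ : setT = [set f : coloring R d | setT (f 0)])// P1T
    probability_setT ltry.
move=> _ [B [mB [F BF]] <-].
by rewrite (color_cylinder col1 mB BF) (color_cylinder col2 mB BF).
Qed.

Lemma color_measure_translate G (nu : probability R R)
    (P : {measure set (coloring R d) -> \bar R}) z : color_measure G nu P ->
  color_measure (translate z G) nu (image_measure P (@measurable_shift_color
    z)).
Proof.
move=> colP; have [marg ind ae] := colP; split.
- move=> x B mB; exact: (marg (x + z) B mB).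
- move=> S distS.
  have /ind indS : in_distinct_clusters G [set x + z | x in S].
    move=> _ _ [x Sx <-] [y Sy <-] xy cl.
    apply: (distS x y Sx Sy) => [xy'|]; first by rewrite xy' in xy.
    by apply: cluster_eq; apply/cluster_translate; rewrite cl;
      exact: cluster_refl.
  apply: (@independent_family_reindex _ _ _ _ _ P _ _ (fun x => x + z) _ _ S
    (@addIr _ z) _ indS).
  by move=> x Sx; exists x.
- move=> S connS.
  have S'conn : connected_in G [set x + z | x in S].
    move=> _ _ [x Sx <-] [y Sy <-]; have [s [ps ls] sS] := connS _ _ Sx Sy.
    exists [seq v + z | v <- s]; last first.
      by move=> _ /= /mapP[v vs ->]; exists v => //; exact: sS.
    split; last by rewrite (last_map (fun v : vertex d => v + z)) ls.
    apply: (homo_path (f := fun v : vertex d => v + z)) ps => a b /= /asboolP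
      ab.
    exact/asboolP/adjacent_translate.
  exists (disagree S); split.
  + exact: measurable_disagree.
  + rewrite -(color_disagree0 colP S'conn); congr (P _); apply/seteqP;
      split => f /=.
      by move=> [x [y [Sx Sy fxy]]]; exists (x + z), (y + z); split;
        [exists x|exists y|].
    by move=> [_ [_ [[x Sx <-] [y Sy <-] fxy]]]; exists x, y.
  + move=> f /= nf; apply: contrapT => nd; apply: nf => x y Sx Sy.
    by apply: contrapT => fxy; apply: nd; exists x, y.
Qed.

End color.

(** * The joint law *)

Section joint.
Context (R : realType) (d : nat) (p : R) (mu : probability (subgraph d) R).
Context (nu : probability R R) (color : R.-pker (subgraph d) ~> (coloring R d)).
Hypotheses (muB : bernoulli_percolation p mu)
  (color_nu : forall G : subgraph d, color_measure G nu (color G)).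
Implicit Types (G : subgraph d) (x y z : vertex d) (w : subgraph d * coloring R
  d).

Definition shift z w : subgraph d * coloring R d :=
  (translate z w.1, shift_color z w.2).

Lemma measurable_shift z : measurable_fun setT (shift z).
Proof.
apply: measurable_fun_pair.
- by apply: measurableT_comp;
    [exact: measurable_translate|exact: measurable_fst].
- by apply: measurableT_comp;
    [exact: measurable_shift_color|exact: measurable_snd].
Qed.

Lemma shiftD x z w : shift x (shift z w) = shift (x + z) w.
Proof.
case: w => G f; congr pair; apply/funext => e /=.
- rewrite /translate; congr G.
  have [a [b [eab _]]] := edge_ends e.
  apply: val_inj; rewrite [RHS](_ : _ = [fset (a + (x + z))%R;
    (b + (x + z))%R]%fset); last first.
    exact/translate_edgeE.
  by rewrite !addrA; apply/translate_edgeE/translate_edgeE.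
- by rewrite /shift_color addrA.
Qed.

Local Notation P := (joint_law mu color).

Lemma joint_lawE A : P A = (\int[mu]_G color G (xsection A G))%E.
Proof. by []. Qed.

(** Shifting the colors drawn on [G] gives a color measure for the translated graph, hence by
    uniqueness the kernel there; invariance of [mu] finishes. *)
Lemma joint_law_shift z A : measurable A -> P (shift z @^-1` A) = P A.
Proof.
move=> mA; rewrite !joint_lawE.
transitivity (\int[mu]_G ((fun G => color G (xsection A G)) (translate z G)))%E.
  apply: eq_integral => G _.
  have := color_measure_unique (color_measure_translate z (color_nu G))
    (color_nu (translate z G)).
  move=> /(_ (xsection A (translate z G)) (measurable_xsection _ mA)) <-.
  by rewrite !xsectionE.
have mk : measurable_fun setT (fun G => color G (xsection A G)).
  by apply: measurable_fun_xsection_finite_kernel; rewrite inE.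
rewrite -[LHS](ge0_integral_pushforward (@measurable_translate d z) mu
  measurableT
   (f := fun G => color G (xsection A G)))//.
apply: (@eq_measure_integral _ _ _ _ mu (image_measure mu
  (@measurable_translate d z))) => C mC _.
exact: bernoulli_translate muB z C mC.
Qed.

(** The conditional probability of [C] is asked to be constant on [A] only. This allows [A] to force
    two sites into distinct clusters, where their colors are independent. *)
Lemma joint_law_rect (A : set (subgraph d)) (C : set (coloring R d)) (c : \bar
  R) :
  measurable A -> (forall G, A G -> color G C = c) -> (0 <= c)%E ->
  P [set w | A w.1 /\ C w.2] = (c * mu A)%E.
Proof.
move=> mA AC c0; rewrite joint_lawE.
transitivity (\int[mu]_G (c * (\1_A G)%:E))%E.
  apply: eq_integral => G _; rewrite indicE; have [AG|AG] := boolP (G \in A).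
    rewrite mule1 -(AC G); last exact: set_mem.
    rewrite xsectionE; congr (color G _); apply/seteqP; split => f /=;
      first by case.
    by move=> Cf; split => //; exact: set_mem.
  rewrite mule0 (_ : xsection _ G = set0) ?measure0//.
  rewrite xsectionE; apply/seteqP; split => f //= -[AG' _].
  by rewrite (mem_set AG') in AG.
have mI : measurable_fun setT (fun G : subgraph d => (\1_A G)%:E : \bar R).
  by apply/measurable_EFinP; exact: measurable_indic.
by rewrite ge0_integralZl// integral_indic// setIT.
Qed.

Lemma joint_law_fst (A : set (subgraph d)) : measurable A -> P [set w | A w.1]
  = mu A.
Proof.
move=> mA; have := @joint_law_rect A setT 1%E mA.
rewrite mul1e => <-//; first by congr (joint_law mu color _); apply/seteqP;
  split => w //= -[].
by move=> G _; rewrite prob_kernel.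
Qed.

Lemma joint_law_color x (B : set R) : measurable B -> P [set w | B (w.2 x)] =
  nu B.
Proof.
move=> mB; have := @joint_law_rect setT [set f : coloring R d | B (f x)] (nu B)
  measurableT.
rewrite probability_setT mule1 => <-//.
  by congr (joint_law mu color _); apply/seteqP; split => w //= -[].
by move=> G _; have [marg _ _] := color_nu G; exact: marg.
Qed.

Definition small_cluster K : set (subgraph d) := [set G | cluster G 0 `<=` box
  d K].

Definition local_event (B : set R) K : set (subgraph d * coloring R d) :=
  [set w | small_cluster K w.1 /\ B (w.2 0)].

Lemma measurable_small_cluster K : measurable (small_cluster K).
Proof. exact: measurable_cluster_sub. Qed.

Lemma measurable_fst_event (A : set (subgraph d)) : measurable A ->
  measurable [set w : subgraph d * coloring R d | A w.1].
Proof.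
move=> mA; rewrite -[X in measurable X]setTI.
exact: (@measurable_fst _ _ (subgraph d) (coloring R d)).
Qed.

Lemma measurable_snd_event x (B : set R) : measurable B ->
  measurable [set w : subgraph d * coloring R d | B (w.2 x)].
Proof.
move=> mB; have := @measurable_snd _ _ (subgraph d) (coloring R d) measurableT _
  (measurable_color x mB).
by rewrite setTI.
Qed.

Lemma measurable_local_event B K : measurable B -> measurable (local_event B K).
Proof.
move=> mB; apply: measurableI.
- by apply: measurable_fst_event; exact: measurable_small_cluster.
- exact: measurable_snd_event.
Qed.

Lemma joint_law_local_event B K : measurable B ->
  P (local_event B K) = (nu B * mu (small_cluster K))%E.
Proof.
move=> mB; apply: (@joint_law_rect (small_cluster K) [set f : coloring R d | B
  (f 0)]) => //; first exact: measurable_small_cluster.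
by move=> G _; have [marg _ _] := color_nu G; exact: marg.
Qed.

Lemma small_cluster_translate K z G :
  small_cluster K (translate z G) <-> cluster G z `<=` tbox z K.
Proof.
split=> [sub y zy|sub y].
  by apply: sub; apply/cluster_translate; rewrite add0r subrK.
by move=> /cluster_translate; rewrite add0r => /sub; rewrite /tbox /= addrK.
Qed.

(** The radius is [K.+1] because the edges leading out of the box of radius [K] must be seen to be
    closed. *)
Lemma depends_small_cluster K z :
  depends_on (edges_in (tbox z K.+1)) (translate z @^-1` small_cluster K).
Proof.
move=> G G' GG' /small_cluster_translate sub;
  apply/small_cluster_translate => y.
move=> zy; apply: (sub); move: y zy.
apply: (@cluster_ind _ G' z (cluster G z)); first exact: cluster_refl.
move=> u v _ zu [e [euv G'e]]; apply: (cluster_step zu); exists e; split => //.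
rewrite GG'//; apply/mem_edges_in; first exact: finite_tbox.
have uK := sub _ zu.
move=> a; rewrite euv !inE => /orP[]/eqP->; first by apply: box_le uK.
have vu : box d 1 (v - u) by apply/boxN; rewrite opprB;
  exact: edge_ends_box euv.
by have := boxD vu uK; rewrite addrA subrK add1n.
Qed.

(** The two clusters are confined to disjoint boxes. They are therefore distinct, which makes the
    colors independent, and the two confinement events depend on disjoint sets of edges. *)
Lemma joint_law_far_local_events B K x : measurable B -> ~ box d (K.+1 + K.+1)
  x ->
  P (local_event B K `&` shift x @^-1` local_event B K) =
  ((nu B * mu (small_cluster K)) * (nu B * mu (small_cluster K)))%E.
Proof.
move=> mB far.
have dep0 : depends_on (edges_in (tbox 0 K.+1)) (small_cluster K).
  move=> G G' GG' sG; have := @depends_small_cluster K 0 G G' GG'.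
  have tr0 H : small_cluster K (translate 0 H) <-> small_cluster K H.
    rewrite small_cluster_translate; split => sub y /sub;
      rewrite /tbox /= subr0//.
  by move=> h; apply/tr0/h/tr0.
have disj : [disjoint edges_in (tbox 0 K.+1) & edges_in (tbox x K.+1)]%fset.
  apply: edges_in_disjoint; [exact: finite_tbox|exact: finite_tbox|].
  apply/seteqP; split => y // [y0 yx]; apply: far.
  have y0' : box d K.+1 y by move: y0; rewrite /tbox /= subr0.
  have yx' : box d K.+1 (x - y) by apply/boxN; rewrite opprB.
  by have := boxD yx' y0'; rewrite subrK.
have -> : local_event B K `&` shift x @^-1` local_event B K =
    [set w | (small_cluster K `&` translate x @^-1` small_cluster K) w.1 /\
       [set f : coloring R d | B (f 0) /\ B (f x)] w.2].
  apply/seteqP; split => w; rewrite /local_event /shift /shift_color /= add0r.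
    by move=> [[? ?] [? ?]].
  by move=> [[? ?] [? ?]].
rewrite (@joint_law_rect _ _ (nu B * nu B)%E); last 3 first.
- apply: measurableI; first exact: measurable_small_cluster.
  rewrite -[X in measurable X]setTI; apply: measurable_translate => //.
  exact: measurable_small_cluster.
- move=> G [sub0 _].
  have [marg ind _] := color_nu G.
  have x0 : x != 0 by apply/eqP => x0; apply: far; rewrite x0; exact: box0.
  have dist : in_distinct_clusters G [set` [fset 0; x]%fset].
    have n0x : ~ cluster G 0 x.
      by move=> /sub0 xK; apply: far; apply: box_le xK; lia.
    move=> a b /=; rewrite !inE => /orP[]/eqP-> /orP[]/eqP-> // _ cl;
      apply: n0x.
      by rewrite cl; exact: cluster_refl.
    by rewrite -cl; exact: cluster_refl.
  have := ind _ dist [fset 0; x]%fset (fun=> B) (fun _ => id) (fun _ _ => mB).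
  rewrite big_fsetU1 ?inE 1?eq_sym//= big_seq_fset1 !marg// => <-.
  congr (color G _); apply/seteqP; split => f /=.
    by move=> [f0 fx] y; rewrite /= !inE => /orP[]/eqP->.
  by move=> h; split; [apply: (h 0)|apply: (h x)] => /=;
    rewrite !inE eqxx ?orbT.
- by rewrite mule_ge0.
rewrite (bernoulli_indep muB disj dep0 (@depends_small_cluster K x)).
rewrite (bernoulli_translate muB x (measurable_small_cluster K)).
by rewrite muleACA.
Qed.

End joint.

(** * The law of large numbers *)

Section simple_approximation.
Import HBSimple.
Context (disp : measure_display) (T : measurableType disp) (R : realType)
  (P : probability T R).

Definition step_fun (r : seq R) (B : R -> set T) (x : T) : R :=
  \sum_(v <- r) v * \1_(B v) x.

Lemma step_fun_approx (phi : T -> R) (eps : R) : P.-integrable setT (EFin \o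
  phi) ->
  0 < eps -> exists (r : seq R) (B : R -> set T),
    (forall v, measurable (B v)) /\
    (\int[P]_x (`|phi x - step_fun r B x|)%:E <= eps%:E)%E.
Proof.
move=> iphi eps0.
have [g [_ _ g0]] := approximation_sfun_integrable measurableT iphi.
have [n gn] : exists n, (\int[P]_x `|(EFin \o phi) x - (g n x)%:E| <= eps%:E)%E.
  apply: contrapT => h.
  have : (eps%:E <= 0)%E.
    apply: (cvge_ge _ g0); apply: nearW => n; apply: ltW; rewrite ltNge.
    by apply/negP => gn; apply: h; exists n.
  by rewrite lee_fin leNgt eps0.
exists (fset_set (range (g n))), (fun v => g n @^-1` [set v]); split.
  by move=> v; exact: measurable_funPTI.
apply: le_trans gn; rewrite le_eqVlt; apply/orP; left; apply/eqP.
apply: eq_integral => x _.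
by rewrite [X in (X - _)%E]/= [in RHS]fimfunE fsbig_finite.
Qed.

Lemma measurable_step_fun r (B : R -> set T) : (forall v, measurable (B v)) ->
  measurable_fun setT (step_fun r B).
Proof.
move=> mB; apply: measurable_sum => v; apply: measurable_funM => //.
Qed.

Lemma step_fun_bound r (B : R -> set T) x : `|step_fun r B x| <= \sum_(v <- r)
  `|v|.
Proof.
apply: (le_trans (ler_norm_sum _ _ _)); apply: ler_sum => v _.
by rewrite normrM indicE; case: (_ \in _);
  rewrite ?normr1 ?mulr1// normr0 mulr0.
Qed.

Lemma integrable_step_fun r (B : R -> set T) : (forall v, measurable (B v)) ->
  P.-integrable setT (EFin \o step_fun r B).
Proof.
move=> mB; rewrite (_ : _ \o _ = fun x => (\sum_(v <- r) v%:E * (\1_(B v)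
  x)%:E)%E).
  apply: integrable_sum => // v _; apply: integrableZl => //;
    exact: integrable_indic.
by apply/funext => x; rewrite /= -sumEFin; apply: eq_bigr => v _; rewrite EFinM.
Qed.

Lemma integral_step_fun r (B : R -> set T) : (forall v, measurable (B v)) ->
  \int[P]_x step_fun r B x = \sum_(v <- r) v * fine (P (B v)).
Proof.
move=> mB; rewrite /Rintegral.
under eq_integral do rewrite /step_fun -sumEFin.
rewrite integral_sum//; last first.
  move=> v; under eq_fun do rewrite EFinM.
  by apply: integrableZl => //; exact: integrable_indic.
rewrite (eq_bigr (fun v => (v * fine (P (B v)))%:E)) ?sumEFin//.
move=> v _; under eq_integral do rewrite EFinM.
rewrite integralZl//; last exact: integrable_indic.
by rewrite integral_indic// setIT EFinM fineK// fin_num_measure.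
Qed.

End simple_approximation.

Section law_of_large_numbers.
Context (R : realType) (d : nat) (p : R) (mu : probability (subgraph d) R).
Context (nu : probability R R) (color : R.-pker (subgraph d) ~> (coloring R d)).
Hypotheses (d_gt0 : (0 < d)%N) (muB : bernoulli_percolation p mu)
  (color_nu : forall G : subgraph d, color_measure G nu (color G)).
Implicit Types (G : subgraph d) (x y z : vertex d) (w : subgraph d * coloring R
  d).

Local Notation P := (joint_law mu color).

Definition finite_origin : set (subgraph d) :=
  [set G | ~ infinite_set (cluster G 0)].

Lemma measurable_finite_origin : measurable finite_origin.
Proof. by apply: measurableC; exact: measurable_infinite_cluster. Qed.

Lemma mu_finite_origin : mu finite_origin = (1 - theta mu)%:E.
Proof.
have mI := measurable_infinite_cluster (0 : vertex d).
rewrite (_ : finite_origin = ~` [set G | infinite_set (cluster G 0)])//.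
rewrite probability_setC// EFinB; congr (_ - _)%E.
by rewrite /theta fineK// fin_num_measure.
Qed.

Lemma small_cluster_finite K : small_cluster K `<=` finite_origin.
Proof.
move=> G sub /infinite_clusterP/(_ K)[y /sub yK]; apply.
by rewrite /tbox /= subr0.
Qed.

Lemma small_cluster_exhaust (eps : R) : 0 < eps ->
  exists K, 1 - theta mu - fine (mu (small_cluster K)) <= eps.
Proof.
move=> eps0; apply: contrapT => h.
have E : finite_origin = \bigcup_K small_cluster K.
  apply/seteqP; split => G; last by move=> [K _]; exact: small_cluster_finite.
  move=> fin; apply: contrapT => nK; apply: fin; apply/infinite_clusterP => K.
  apply: contrapT => nout; apply: nK; exists K => // y zy.
  apply: contrapT => yK; apply: nout; exists y => //.
  by rewrite /tbox /= subr0.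
have cv : mu \o (@small_cluster d) @ \oo --> mu finite_origin.
  rewrite E; apply: nondecreasing_cvg_mu.
  - by move=> K; exact: measurable_small_cluster.
  - by rewrite -E; exact: measurable_finite_origin.
  - move=> m n mn; apply/subsetPset => G sub y zy;
      exact: box_le mn _ (sub _ zy).
have : (mu finite_origin <= (1 - theta mu - eps)%:E)%E.
  apply: (cvge_le _ cv); apply: nearW => K /=.
  rewrite -[X in (X <= _)%E]fineK ?fin_num_measure//;
    last exact: measurable_small_cluster.
  rewrite lee_fin leNgt; apply/negP => lt; apply: h; exists K; lra.
by rewrite mu_finite_origin lee_fin; lra.
Qed.

Lemma integral_joint_color (g : R -> R) : measurable_fun setT g -> (forall r, 0
  <= g r) ->
  (\int[P]_w (g (w.2 0))%:E = \int[nu]_r (g r)%:E)%E.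
Proof.
move=> mg g0.
have m0 : measurable_fun setT (fun w : subgraph d * coloring R d => w.2 0).
  apply: (measurableT_comp (@measurable_coordinate _ _ _ (0 : vertex d))).
  exact: measurable_snd.
rewrite -[LHS](ge0_integral_pushforward m0 P measurableT (f := EFin \o g)).
- apply: (@eq_measure_integral _ _ _ _ nu (image_measure P m0)) => B mB _.
  exact: (joint_law_color mu color_nu 0 mB).
- exact/measurable_EFinP.
- by move=> r _; rewrite /= lee_fin.
Qed.

Lemma averages_to_local (B : set R) K : measurable B ->
  averages_to P (@shift R d) \1_(local_event B K)
    (fine (nu B) * fine (mu (small_cluster K))).
Proof.
move=> mB.
have mK := @measurable_small_cluster d K.
apply: (averages_to_indic (@measurable_shift R d) (joint_law_shift muB color_nu)
  (@shiftD R d) (L := (K.+1 + K.+1)%N)) => //.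
- exact: measurable_local_event.
- rewrite [LHS](joint_law_local_event mu color_nu K mB) EFinM !fineK
    ?fin_num_measure//.
- move=> x far; rewrite [LHS](joint_law_far_local_events muB color_nu mB far).
  by rewrite expr2 !EFinM !fineK ?fin_num_measure.
Qed.

(** Two approximations at once: [phi] by a step function in L^1 of [nu], and finiteness of the
    cluster of the origin by confinement to a box. *)
Lemma averages_to_finite (phi : R -> R) : nu.-integrable setT (EFin \o phi) ->
  averages_to P (@shift R d) (fun w => phi (w.2 0) * \1_finite_origin w.1)
    ((1 - theta mu) * \int[nu]_r phi r).
Proof.
move=> iphi.
have mphi : measurable_fun setT phi by apply/measurable_EFinP;
  case/integrableP: iphi.
have mcol : measurable_fun setT (fun w : subgraph d * coloring R d => w.2 0).
  apply: (measurableT_comp (@measurable_coordinate _ _ _ (0 : vertex d))).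
  exact: measurable_snd.
have mfin := measurable_finite_origin.
have mK K := @measurable_small_cluster d K.
have mfst (A : set (subgraph d)) : measurable A ->
    measurable_fun setT (fun w : subgraph d * coloring R d => \1_A w.1 : R).
  move=> mA; have mA' : measurable [set w : subgraph d * coloring R d | A w.1].
    exact: measurable_fst_event.
  rewrite (_ : (fun w => _) = \1_[set w : subgraph d * coloring R d | A w.1]).
    exact: measurable_indic.
  by apply/funext => w; rewrite !indicE.
apply: (averages_to_approx (@measurable_shift R d) (joint_law_shift muB
  color_nu) (@shiftD R d)).
  by apply: measurable_funM; [exact: measurableT_comp mphi mcol|exact: mfst].
move=> eps eps0.
have eps20 : 0 < eps / 2 by rewrite divr_gt0.
have [r [B [mB approx]]] := step_fun_approx iphi eps20.
pose s := step_fun r B.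
have ms : measurable_fun setT s by exact: measurable_step_fun.
(* [M] bounds the step function, so it is also the price of each cluster that is finite but not
   confined; [K] is chosen after it. [M + 1] below covers the case [M = 0]. *)
pose M := \sum_(v <- r) `|v|.
have M0 : 0 <= M by exact: sumr_ge0.
have M10 : 0 < 2 * (M + 1) by lra.
have [K Keps] := small_cluster_exhaust (divr_gt0 eps0 M10).
set aK := fine (mu (small_cluster K)) in Keps.
set t := 1 - theta mu in Keps *.
have tE : t = fine (mu finite_origin) by rewrite mu_finite_origin.
have t01 : 0 <= t <= 1.
  by rewrite -!lee_fin tE fineK ?fin_num_measure// measure_ge0 probability_le1.
have aKt : aK <= t.
  rewrite -lee_fin tE !fineK ?fin_num_measure//; apply: le_measure;
    rewrite ?inE//.
  exact: small_cluster_finite.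
have MK : M * (t - aK) <= eps / 2.
  apply: (@le_trans _ _ ((M + 1) * (eps / (2 * (M + 1))))).
    by apply: ler_pM => //; lra.
  by rewrite le_eqVlt; apply/orP; left; apply/eqP; field; lra.
have is_ := integrable_step_fun nu r mB.
have intD : `|\int[nu]_x phi x - \int[nu]_x s x| <= eps / 2.
  rewrite -RintegralB//.
  apply: (le_trans (le_normr_Rintegral measurableT _)).
    rewrite (_ : _ \o _ = (EFin \o phi) \- (EFin \o s))%E;
      first exact: integrableB.
    by [].
  rewrite /Rintegral -lee_fin fineK//.
  rewrite ge0_fin_numE; last by apply: integral_ge0 => x _; rewrite lee_fin.
  exact: le_lt_trans approx (ltry _).
have sM : `|\int[nu]_x s x| <= M.
  rewrite (integral_step_fun nu r mB); apply: (le_trans (ler_norm_sum _ _ _)).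
  apply: ler_sum => v _; rewrite normrM ler_piMr// ger0_norm ?fine_ge0//.
  by rewrite -lee_fin fineK ?fin_num_measure// probability_le1.
exists (fun w => \sum_(v <- r) v * \1_(local_event (B v) K) w), (aK *
  \int[nu]_x s x).
split.
- apply: measurable_sum => v; apply: measurable_funM => //;
    apply: measurable_indic.
  exact: measurable_local_event.
- rewrite (integral_step_fun nu r mB) mulr_sumr.
  apply: averages_to_sum => v; rewrite mulrCA [aK * _]mulrC.
  apply: averages_toZ; exact: averages_to_local.
- set m := \int[nu]_x phi x in intD *; set S := \int[nu]_x s x in intD sM *.
  have -> : t * m - aK * S = t * (m - S) + (t - aK) * S by ring.
  apply: (le_trans (ler_normD _ _)); rewrite (splitr eps); apply: lerD.
    rewrite normrM ger0_norm; last by case/andP: t01.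
    apply: le_trans intD; rewrite ler_piMl//; by case/andP: t01.
  rewrite normrM ger0_norm ?subr_ge0//; apply: le_trans MK.
  by rewrite mulrC ler_wpM2r ?subr_ge0.
have hE w : \sum_(v <- r) v * \1_(local_event (B v) K) w = s (w.2 0) *
  \1_(small_cluster K) w.1.
  rewrite /s /step_fun mulr_suml; apply: eq_bigr => v _; rewrite -mulrA;
    congr (_ * _).
  rewrite (_ : local_event (B v) K = [set w : subgraph d * coloring R d |
    small_cluster K w.1] `&`
    [set w : subgraph d * coloring R d | B v (w.2 0)])//.
  by rewrite indicI mulrC.
under eq_integral do rewrite hE.
have mphis : measurable_fun setT (fun x : R => `|phi x - s x|).
  by apply: measurableT_comp => //; exact: measurable_funB.
pose D := finite_origin `\` small_cluster K.
have mD : measurable D by exact: measurableD.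
(* On [D], where the cluster is finite but too large, the approximant vanishes and |phi| <= |phi -
   s| + M; on small clusters the error is |phi - s|; on infinite ones it is zero. *)
apply: (@le_trans _ _ (\int[P]_w ((`|phi (w.2 0) - s (w.2 0)|)%:E + (M * \1_D
  w.1)%:E))%E).
  apply: ge0_le_integral => //.
  - apply/measurable_EFinP; apply: measurableT_comp => //;
      apply: measurable_funB.
      by apply: measurable_funM;
        [exact: measurableT_comp mphi mcol|exact: mfst].
    by apply: measurable_funM; [exact: measurableT_comp ms mcol|exact: mfst].
  - apply: emeasurable_funD; apply/measurable_EFinP.
      exact: measurableT_comp mphis mcol.
    by apply: measurable_funM => //; exact: mfst.
  - move=> w _; rewrite -EFinD lee_fin !indicE.
    have sw : `|s (w.2 0)| <= M by exact: step_fun_bound.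
    have [Kw|nKw] := pselect (small_cluster K w.1).
      have fw := small_cluster_finite Kw.
      have nD : ~ D w.1 by case.
      by rewrite (mem_set Kw) (mem_set fw) memNset// !mulr1 mulr0 addr0.
    rewrite [w.1 \in small_cluster K]memNset// mulr0 subr0.
    have [fw|nfw] := pselect (finite_origin w.1); last first.
      have nD : ~ D w.1 by case.
      by rewrite !memNset// !mulr0 normr0 addr0.
    have Dw : D w.1 by split.
    rewrite (mem_set fw) (mem_set Dw) !mulr1.
    rewrite -[X in `|X| <= _](subrK (s (w.2 0))).
    by apply: (le_trans (ler_normD _ _)); rewrite lerD2l.
rewrite ge0_integralD//; last 3 first.
- by apply/measurable_EFinP; exact: measurableT_comp mphis mcol.
- by move=> w _; rewrite lee_fin mulr_ge0.
- by apply/measurable_EFinP; apply: measurable_funM => //; exact: mfst.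
rewrite [X in (X + _)%E](integral_joint_color mphis) //.
rewrite (splitr eps) EFinD; apply: leeD; first exact: approx.
have -> : (\int[P]_w (M * \1_D w.1)%:E = (M * (t - aK))%:E)%E.
  under eq_integral do rewrite EFinM.
  rewrite ge0_integralZl//; last by apply/measurable_EFinP; exact: mfst.
  rewrite (_ : (\int[P]_w (\1_D w.1)%:E)%E = P [set w | D w.1]); last first.
    transitivity (\int[P]_w (\1_[set w : subgraph d * coloring R d | D w.1]
      w)%:E)%E.
      by apply: eq_integral => w _; rewrite !indicE.
    by rewrite integral_indic// ?setIT//; exact: measurable_fst_event.
  rewrite [X in (_ * X)%E](joint_law_fst mu color mD) EFinM; congr (_ * _)%E.
  rewrite /D measureD//; last by rewrite -ge0_fin_numE ?fin_num_measure.
  rewrite setIidr; last exact: small_cluster_finite.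
  by rewrite EFinB tE /aK !fineK// fin_num_measure.
by rewrite lee_fin.
Qed.

End law_of_large_numbers.

(** * The infinite cluster and the conclusion *)

Lemma negligible_bigcup_countable (disp : measure_display) (T : measurableType
  disp)
    (R : realType) (P : {measure set T -> \bar R}) (I : countType) (F : I ->
      set T) :
  (forall i, P.-negligible (F i)) -> P.-negligible (\bigcup_i F i).
Proof.
move=> nF.
have nU : P.-negligible (\bigcup_n (if choice.unpickle n is Some i then F i
  else set0)).
  apply: negligible_bigcup => n; case: choice.unpickle => [i|].
    exact: nF.
  exact: negligible_set0.
by apply: negligibleS nU => x [i _ Fix]; exists (choice.pickle i) => //;
  rewrite choice.pickleK.
Qed.

Section infinite_cluster.
Context (R : realType) (d : nat) (p : R) (mu : probability (subgraph d) R).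
Context (nu : probability R R) (color : R.-pker (subgraph d) ~> (coloring R d)).
Hypotheses (p01 : 0 < p < 1) (muB : bernoulli_percolation p mu)
  (color_nu : forall G : subgraph d, color_measure G nu (color G)).

(** The value is read at an arbitrarily chosen infinite site. It is the common color unless some
    pair of sites lies in two infinite clusters, or in one cluster with different colors; there are
    countably many pairs. *)
Lemma infinite_cluster_valueP :
  {ae joint_law mu color, forall w : subgraph d * coloring R d, forall x :
    vertex d,
    infinite_set (cluster w.1 x) -> w.2 x = infinite_cluster_value w.1 w.2}.
Proof.
pose two (xy : vertex d * vertex d) : set (subgraph d * coloring R d) :=
  [set w | distinct_infinite xy.1 xy.2 w.1].
pose bad (xy : vertex d * vertex d) : set (subgraph d * coloring R d) :=
  [set w | cluster w.1 xy.1 xy.2 /\ w.2 xy.1 <> w.2 xy.2].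
have two0 xy : (joint_law mu color).-negligible (two xy).
  have mDI := measurable_distinct_infinite xy.1 xy.2.
  exists (two xy); split => //; first exact: measurable_fst_event.
  by rewrite [LHS](joint_law_fst mu color mDI) (distinct_infinite_null p01 muB).
have bad0 xy : (joint_law mu color).-negligible (bad xy).
  have mC := measurable_cluster xy.1 xy.2.
  pose S : set (vertex d) := [set xy.1; xy.2].
  exists [set w | cluster w.1 xy.1 xy.2 /\ disagree S w.2]; split.
  - apply: measurableI.
      exact: (@measurable_fst_event R d [set G | cluster G xy.1 xy.2]).
    have := @measurable_snd _ _ (subgraph d) (coloring R d) measurableT _
      (@measurable_disagree R d S).
    by rewrite setTI.
  - rewrite [LHS](@joint_law_rect R d mu color [set G | cluster G xy.1 xy.2]
      (disagree S) 0%E)//.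
      by rewrite mul0e.
    move=> G cG; have /= := color_disagree0 (color_nu G) (@connected_cluster d
      G xy.1).
    move=> D0; apply/eqP; rewrite -measure_le0 -D0; apply: le_measure;
      rewrite ?inE.
    + exact: measurable_disagree.
    + exact: measurable_disagree.
    + have Scl u : S u -> cluster G xy.1 u by case=> ->//; exact: cluster_refl.
      by move=> f [u [v [/Scl Su /Scl Sv fuv]]]; exists u, v.
  - move=> w [cw ne]; split => //; exists xy.1, xy.2; split => //;
      [by left|by right].
have := negligibleU (negligible_bigcup_countable two0)
  (negligible_bigcup_countable bad0).
apply: negligibleS => w nP; apply: contrapT => good; apply: nP => x xinf.
have exinf : infinite_sites w.1 !=set0 by exists x.
rewrite /infinite_cluster_value; case: asboolP => // _.
set y := xget 0 (infinite_sites w.1).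
have yinf : infinite_set (cluster w.1 y) := xgetPex 0 exinf.
have xy : cluster w.1 x y.
  by apply: contrapT => nxy; apply: good; left; exists (x, y).
by apply: contrapT => ne; apply: good; right; exists (x, y).
Qed.

End infinite_cluster.

Theorem corollary2 (R : realType) (d : nat) (d_ge1 : (1 <= d)%N)
    (mu : R -> probability (subgraph d) R)
    (mu_percolation : forall q : R, 0 < q < 1 -> bernoulli_percolation q (mu q))
    (nu : probability R R)
    (nu_first_moment : nu.-integrable [set: R] (fun x : R => x%:E))
    (color : R.-pker (subgraph d) ~> (coloring R d))
    (color_nu : forall G : subgraph d, color_measure G nu (color G))
    (p : R) (p01 : 0 < p < 1) (p_neq_pc : p <> critical_probability mu) :
  {ae joint_law (mu p) color, forall GX : subgraph d * coloring R d,
    (fun n : nat => (#|` fset_set (box d n)|%:R)^-1 *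
                    \sum_(x \in box d n) GX.2 x) @ \oo -->
      (1 - theta (mu p)) * (\int[nu]_x x)%R +
      theta (mu p) * infinite_cluster_value GX.1 GX.2}.
Proof.
have muB := mu_percolation _ p01.
have lln_id := averages_to_finite d_ge1 muB color_nu (phi := id)
  nu_first_moment.
have int1 : nu.-integrable [set: R] (EFin \o cst 1).
  exact: finite_measure_integrable_cst.
have lln_1 := averages_to_finite d_ge1 muB color_nu int1.
have val_ae := infinite_cluster_valueP p01 muB color_nu.
apply: filterS3 lln_id lln_1 val_ae => w cvg_id cvg_1 valE.
set Z := infinite_cluster_value _ _ in valE *.
have int_cst1 : \int[nu]_r (cst 1 r : R) = 1.
  rewrite Rintegral_cst// mul1r [X in fine X](_ : _ = 1%E)//.
  exact: probability_setT.
rewrite int_cst1 mulr1 in cvg_1.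
(* [theta] is written as 1 - (1 - theta) because the density of infinite sites is obtained as one
   minus the average of the indicator of finite clusters. *)
have -> : (1 - theta (mu p)) * (\int[nu]_x x) + theta (mu p) * Z =
    (1 - theta (mu p)) * (\int[nu]_x id x) + Z * (1 - (1 - theta (mu p))).
  by rewrite opprB addrCA subrr addr0 [Z * _]mulrC.
rewrite [X in X @ _ --> _](_ : _ = fun n =>
    average (@shift R d) n (fun w => id (w.2 0) * \1_(@finite_origin d) w.1) w +
    Z * (1 - average (@shift R d) n (fun w => cst 1 (w.2 0) *
      \1_(@finite_origin d) w.1) w)).
  by apply: cvgD cvg_id _; apply: cvgMr; apply: cvgB => //; exact: cvg_cst.
apply/funext => n; rewrite fsbig_finite/=; last exact: finite_box.
have avg1 := average_cst (@shift R d) n (1 : R) w.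
rewrite -[X in Z * (X - _)]avg1.
rewrite /average -mulrBr mulrCA -mulrDr; congr (_ * _).
(* Site by site: a vertex in a finite cluster contributes its color to the first average and nothing
   to the second term; a vertex in an infinite cluster contributes [Z]. *)
rewrite -sumrB mulr_sumr -big_split/=; apply: eq_bigr => x _.
rewrite /shift_color /= add0r mul1r indicE.
have [fin|inf] := pselect (finite_origin (translate x w.1)).
  by rewrite (mem_set fin) mulr1 subrr mulr0 addr0.
rewrite memNset// mulr0 subr0 mulr1 add0r; apply: valE.
by move: inf => /contrapT/infinite_cluster_translate; rewrite add0r.
Qed.
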